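(* Let ${\mathcal G}=(B\cup W,E)$ be a finite bipartite graph embedded in the plane (without boundary vertices), each of whose bounded faces is bounded by a simple cycle, with vertex multiplicities $\mathbf n$ satisfying $\sum_{b\in B}n_b=\sum_{w\in W}n_w$, a choice of cilia, a connection $\Phi$, and a Kasteleyn sign function $\epsilon$. Let $\widetilde K$ be the square matrix with rows indexed by pairs $(w,i)$, $w\in W$, $1\le i\le n_w$, columns indexed by pairs $(b,j)$, $b\in B$, $1\le j\le n_b$, and entries $\widetilde K_{(w,i),(b,j)}=\epsilon_{bw}(\phi_{bw})_{ij}$ if $b\sim w$ and $0$ otherwise. Then $$\det\widetilde K=\pm\sum_{m\in\Omega_{\mathbf n}({\mathcal G})}\mathrm{Tr}_\Phi(m),$$ with a sign $\pm$ independent of $\Phi$ and of $m$.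
   Context: A vertex multiplicity is a function $\mathbf n:B\cup W\to\mathbb Z_{>0}$, $v\mapsto n_v$. An $\mathbf n$-multiweb is a function $m:E\to\mathbb Z_{\ge0}$ with $\sum_{u\sim v}m_{uv}=n_v$ for every vertex $v$; $\Omega_{\mathbf n}({\mathcal G})$ is the set of $\mathbf n$-multiwebs. A connection $\Phi=\{\phi_{bw}\}_{bw\in E}$ assigns to each edge $bw$ ($b$ black, $w$ white) a real $n_w\times n_b$ matrix $\phi_{bw}$. A choice of cilia assigns to each vertex $v$ a distinguished wedge between two cyclically consecutive incident edges (the cilium ''lies in'' the face containing it); it determines a total order (''edge order'') of the edges at $v$: at a black vertex, counterclockwise starting just after the cilium; at a white vertex, clockwise starting just after the cilium. A Kasteleyn sign function is a map $\epsilon:E\to\{\pm1\}$ such that for every bounded face $f$, whose boundary has length $2\ell$, $\prod_{e\in\partial f}\epsilon_e=(-1)^{\ell+1+k_f}$, where $k_f$ is the number of vertices $v$ on $\partial f$ with $n_v$ even whose cilium lies in $f$. Trace. Let $\mathcal C_v=\{1,\dots,n_v\}$. A coloring of $m\in\Omega_{\mathbf n}({\mathcal G})$ assigns to each edge $e=bw$ with $m_e>0$ subsets $S_e\subset\mathcal C_b$, $T_e\subset\mathcal C_w$ of size $m_e$ such that at each black $b$ the sets $S_{bw}$ partition $\mathcal C_b$ and at each white $w$ the sets $T_{bw}$ partition $\mathcal C_w$. The sign $c_b$ is the signature of the permutation of $\mathcal C_b$ obtained by listing the sets $S_{bw}$ in the edge order at $b$, each in increasing order; $c_w$ is defined likewise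 with the sets $T_{bw}$ in the edge order at $w$. Then $\mathrm{Tr}_\Phi(m)=\sum_C\prod_v c_v\prod_{e=bw:\,m_e>0}\det[(\phi_{bw})_{T_e,S_e}]$, summing over colorings $C$, where $(\phi)_{T,S}$ is the submatrix with rows $T$ and columns $S$ in increasing order. *)

(* Defs.v *)
From HB Require Import structures.
From mathcomp Require Import all_boot all_order all_algebra all_fingroup.
Set Implicit Arguments. Unset Strict Implicit. Unset Printing Implicit Defensive.
Import Order.TTheory GRing.Theory Num.Theory.
Local Open Scope ring_scope.

(* Combinatorial encoding of a finite bipartite plane graph.
   - black vertices B, white vertices W, simple edge relation  adj b w  ("b ~ w");
   - vertices vtx := B + W;
   - darts ((b,w),true) : b -> w  and ((b,w),false) : w -> b  (meaningful when adj b w);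
   - rotation system: sB b is the counterclockwise successor of edges around b
     (a permutation of W that is one cycle on the neighbours of b and fixes the
     other white vertices); sW w likewise around w;
   - faces are the orbits of the face permutation fphi on darts;
   - "outer" marks the darts of the unbounded face. *)

Section PlaneGraph.
Variables (B W : finType) (adj : B -> W -> bool).

Definition vtx := (B + W)%type.

Definition adjV : rel vtx := fun u v =>
  match u, v with
  | inl b, inr w => adj b w
  | inr w, inl b => adj b w
  | _, _ => false
  end.

Definition nonisolated (v : vtx) : bool := [exists u, adjV v u].

Definition dart := (B * W * bool)%type.

Definition is_dart (d : dart) : bool := adj d.1.1 d.1.2.

Definition head (d : dart) : vtx := if d.2 then inr d.1.2 else inl d.1.1.

Variables (sB : B -> {perm W}) (sW : W -> {perm B}).

(* next dart along the boundary of the same face: arrive at v = head d along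
   edge e, leave v along the counterclockwise successor of e at v *)
Definition fphi (d : dart) : dart :=
  let: (b, w, dir) := d in
  if dir then (sW w b, w, false) else (b, sB b w, true).

Definition rotation_system : Prop :=
  [/\ (forall b w, ~~ adj b w -> sB b w = w),
      (forall b w w', adj b w -> adj b w' -> fconnect (sB b) w w'),
      (forall w b, ~~ adj b w -> sW w b = b) &
      (forall w b b', adj b w -> adj b' w -> fconnect (sW w) b b')].

(* genus 0: Euler's formula V - E + F = 2 on every connected component
   having at least one edge (faces of the component on the sphere) *)
Definition euler_genus0 : Prop :=
  forall v : vtx, nonisolated v ->
    (#|[pred u | connect adjV v u]|
       + fcard fphi [pred d | is_dart d && connect adjV v (head d)]
     = #|[pred p : B * W | adj p.1 p.2 && connect adjV v (inl p.1)]| + 2)%N.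

Variable outer : pred dart.

(* the outer darts form exactly one face orbit in each component with edges
   (components lie side by side in the unbounded face) *)
Definition outer_face_ok : Prop :=
  [/\ (forall d, outer d -> is_dart d),
      (forall d, outer (fphi d) = outer d),
      (forall d1 d2, outer d1 -> outer d2 ->
          connect adjV (head d1) (head d2) -> fconnect fphi d1 d2) &
      (forall v, nonisolated v -> exists2 d, outer d & connect adjV v (head d))].

Definition bounded_dart (d : dart) : bool := is_dart d && ~~ outer d.

Definition bounded_faces_simple : Prop :=
  forall d, bounded_dart d ->
    (2 < fingraph.order fphi d)%N /\ {in fconnect fphi d &, injective head}.

Definition plane_bipartite_graph : Prop :=
  [/\ rotation_system, euler_genus0, outer_face_ok & bounded_faces_simple].

(* cilia: the cilium at b lies in the wedge between the edges (b, cB b) and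
   its counterclockwise successor (b, sB b (cB b)); likewise at w. *)
Definition cilia_ok (cB : B -> W) (cW : W -> B) : Prop :=
  (forall b, nonisolated (inl b) -> adj b (cB b)) /\
  (forall w, nonisolated (inr w) -> adj (cW w) w).

Variables (nB : B -> nat) (nW : W -> nat) (cB : B -> W) (cW : W -> B).

(* the wedge (e, ccw successor of e) at v belongs to the face of the dart
   entering v along e *)
Definition k_face (d : dart) : nat :=
  (#|[pred b : B | ~~ odd (nB b) && fconnect fphi d (b, cB b, false)]|
   + #|[pred w : W | ~~ odd (nW w) && fconnect fphi d (cW w, w, true)]|)%N.

Variable R : realFieldType.

Definition kasteleyn (eps : B -> W -> R) : Prop :=
  (forall b w, adj b w -> eps b w = 1 \/ eps b w = -1) /\
  (forall d, bounded_dart d ->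
     \prod_(d' | fconnect fphi d d') eps d'.1.1 d'.1.2
       = (-1) ^+ ((fingraph.order fphi d)./2 + 1 + k_face d)).

Definition degB (b : B) : nat := #|[pred w | adj b w]|.
Definition degW (w : W) : nat := #|[pred b | adj b w]|.

(* at b: counterclockwise, starting just after the cilium *)
Definition edge_order_B (b : B) : seq W :=
  [seq iter k.+1 (sB b) (cB b) | k <- iota 0 (degB b)].
(* at w: clockwise, starting just after the cilium *)
Definition edge_order_W (w : W) : seq B :=
  [seq iter k ((sW w)^-1)%g (cW w) | k <- iota 0 (degW w)].

(* multiwebs: values bounded by the total multiplicity, so this finite type
   contains all n-multiwebs *)
Definition total_mult : nat := (\sum_b nB b)%N.
Definition mweb := {ffun B * W -> 'I_total_mult.+1}.

Definition is_multiweb (m : mweb) : bool :=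
  [&& [forall p : B * W, ~~ adj p.1 p.2 ==> (val (m p) == 0%N)],
      [forall b : B, (\sum_(w : W) val (m (b, w)))%N == nB b] &
      [forall w : W, (\sum_(b : B) val (m (b, w)))%N == nW w]].

(* colorings: colB assigns to each color (b,i), i in C_b, the white neighbour
   w such that i is in S_bw; colW likewise *)
Definition colorsB := {b : B & 'I_(nB b)}.
Definition colorsW := {w : W & 'I_(nW w)}.

Definition Sset (colB : {ffun colorsB -> W}) (b : B) (w : W) : {set 'I_(nB b)} :=
  [set i | colB (existT (fun b => 'I_(nB b)) b i) == w].
Definition Tset (colW : {ffun colorsW -> B}) (b : B) (w : W) : {set 'I_(nW w)} :=
  [set i | colW (existT (fun w => 'I_(nW w)) w i) == b].

Definition is_coloring (m : mweb) (colB : {ffun colorsB -> W})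
  (colW : {ffun colorsW -> B}) : bool :=
  [forall b : B, forall w : W,
     (#|Sset colB b w| == val (m (b, w))) && (#|Tset colW b w| == val (m (b, w)))].

(* signature of the permutation of {0..n-1} whose one-line notation is s *)
Definition sign_of_list (n : nat) (s : seq nat) : R :=
  \sum_(p : 'S_n | [forall k : 'I_n, val (p k) == nth 0%N s k]) (-1) ^+ odd_perm p.

Definition sign_B (colB : {ffun colorsB -> W}) (b : B) : R :=
  sign_of_list (nB b)
    (flatten [seq sort leq [seq val i | i <- enum (Sset colB b w)] | w <- edge_order_B b]).
Definition sign_W (colW : {ffun colorsW -> B}) (w : W) : R :=
  sign_of_list (nW w)
    (flatten [seq sort leq [seq val i | i <- enum (Tset colW b w)] | b <- edge_order_W w]).

(* determinant of a matrix that is square up to the (propositional) equality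
   of its dimensions *)
Definition sqdet (m n : nat) (A : 'M[R]_(m, n)) : R := \det (conform_mx (0 : 'M[R]_m) A).

Definition connection := forall (b : B) (w : W), 'M[R]_(nW w, nB b).

Definition submx_TS (phi : connection) (b : B) (w : W)
  (T : {set 'I_(nW w)}) (S : {set 'I_(nB b)}) : 'M[R]_(#|T|, #|S|) :=
  \matrix_(i < #|T|, j < #|S|) phi b w (enum_val i) (enum_val j).

Definition Tr (phi : connection) (m : mweb) : R :=
  \sum_(colB : {ffun colorsB -> W})
   \sum_(colW : {ffun colorsW -> B} | is_coloring m colB colW)
     ((\prod_(b : B) sign_B colB b) * (\prod_(w : W) sign_W colW w)
      * \prod_(p : B * W | (0 < val (m p))%N)
          sqdet (submx_TS phi (Tset colW p.1 p.2) (Sset colB p.1 p.2))).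

Definition Ktilde (eps : B -> W -> R) (phi : connection)
  : 'M[R]_(#|{: colorsW}|, #|{: colorsB}|) :=
  \matrix_(i, j)
    (let x := enum_val i in let y := enum_val j in
     if adj (projT1 y) (projT1 x)
     then eps (projT1 y) (projT1 x) * phi (projT1 y) (projT1 x) (projT2 x) (projT2 y)
     else 0).

End PlaneGraph.

(* Main.v *)
From HB Require Import structures.
From mathcomp Require Import all_boot all_order all_algebra all_fingroup.
From mathcomp Require Import ring zify.
Require Import Defs.
Set Implicit Arguments. Unset Strict Implicit. Unset Printing Implicit Defensive.
Import Order.TTheory GRing.Theory Num.Theory.
Local Open Scope ring_scope.

(** Expand the determinant over permutations and group them by the coloring they
    induce: each coloring [C] of a multiweb [m] contributes its term of the trace up
    to a sign.  Write that sign as the parity of the inversions between two orders on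
    the strands of [m].  Inserting the orders given by the cilia splits it into a
    constant, the signs [c_v], and a remainder [Q m] which, as a function of [m], is a
    quadratic form over [F_2] depending only on [m] modulo 2.  So [m] may be replaced
    by any mod 2 web, with no positivity, and two of these differ by a mod 2 cycle.
    By Euler's formula and a rank count, such cycles are spanned by bounded faces, and
    it remains to see that [Q (m + z) = Q m] when [z] is the boundary of a bounded
    face.  The polar form of [Q] at [(m, z)] telescopes around the face to the sum of
    the [n_v] over the cilia in the face; [z] splits into two matchings of the cycle,
    which differ by an [l]-cycle, whence the quadratic part of [Q z] is [l + 1] plus
    the number of cilia in the face; Kasteleyn's condition is exactly that these
    contributions and the signs [eps] cancel. *)

(** * Inversions modulo 2 *)

Lemma F2P (x : 'F_2) : x = 0 \/ x = 1.
Proof. by case: x => [[|[|k]] lt_k] //; [left | right]; apply: val_inj. Qed.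

Lemma addF2 (x : 'F_2) : x + x = 0.
Proof. by case: (F2P x) => ->; apply: val_inj. Qed.

Lemma addF2K (x y : 'F_2) : x + (x + y) = y.
Proof. by rewrite addrA addF2 add0r. Qed.

Lemma oppF2 (x : 'F_2) : - x = x.
Proof. by case: (F2P x) => ->; apply: val_inj. Qed.

Lemma mulF2 (x : 'F_2) : x * x = x.
Proof. by case: (F2P x) => ->; rewrite ?mul0r ?mul1r. Qed.

Lemma addF2_eq0 (x y : 'F_2) : (x + y == 0) = (x == y).
Proof. by rewrite -{1}(oppF2 y) subr_eq0. Qed.

Lemma natF2_add (a b : bool) : ((a (+) b) : nat)%:R = a%:R + b%:R :> 'F_2.
Proof. by case: a; case: b; apply: val_inj. Qed.

Lemma natF2_neg (a : bool) : (~~ a : nat)%:R = 1 + a%:R :> 'F_2.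
Proof. by case: a; apply: val_inj. Qed.

Lemma natF2_and (a b : bool) : (a && b : nat)%:R = a%:R * b%:R :> 'F_2.
Proof. by case: a; case: b; apply: val_inj. Qed.

Lemma natF2_odd n : (odd n : nat)%:R = n%:R :> 'F_2.
Proof.
elim: n => // n IHn.
by rewrite oddS natF2_neg IHn -nat1r.
Qed.

(** The nontrivial character of ['F_2]; through it, products of signs are handled as sums in
    ['F_2]. *)
Definition sg (R : pzRingType) (x : 'F_2) : R := (-1) ^+ x.

Lemma sgD (R : pzRingType) (x y : 'F_2) : sg R (x + y) = sg R x * sg R y.
Proof.
rewrite /sg; case: (F2P x) => ->; case: (F2P y) => ->;
  by rewrite ?addr0 ?add0r ?addF2 ?expr0 ?expr1 ?mul1r ?mulr1 ?mulrNN ?mulr1.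
Qed.

Lemma sg0 (R : pzRingType) : sg R 0 = 1. Proof. by []. Qed.

Lemma sg_nat (R : pzRingType) n : sg R n%:R = (-1) ^+ n.
Proof.
elim: n => [|n IHn]; first by rewrite mulr0n sg0.
by rewrite -natr1 sgD IHn exprSr.
Qed.

Lemma sgMn (R : pzRingType) (x : 'F_2) n : sg R (x *+ n) = sg R x ^+ n.
Proof. by elim: n => // n IHn; rewrite mulrS sgD IHn exprS. Qed.

Lemma sg_sum (R : comPzRingType) (I : Type) (s : seq I) (P : pred I) (F : I -> 'F_2) :
  sg R (\sum_(i <- s | P i) F i) = \prod_(i <- s | P i) sg R (F i).
Proof. exact: (big_morph _ (@sgD R) (sg0 R)). Qed.

Lemma sgP (R : pzRingType) x : sg R x = 1 \/ sg R x = -1.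
Proof. by case: (F2P x) => ->; [left | right]. Qed.

(** Since -1 differs from 1, an identity between signs can be read back in ['F_2]; Kasteleyn's
    condition is transferred this way. *)
Lemma sg_inj (R : realFieldType) : injective (sg R).
Proof.
have n1: (-1 : R) != 1 by rewrite lt_eqF // (@lt_trans _ _ 0) ?ltrN10 ?ltr01.
move=> x y; case: (F2P x) => ->; case: (F2P y) => -> //; rewrite /sg /= expr0 expr1 => /eqP.
  by rewrite eq_sym (negPf n1).
by rewrite (negPf n1).
Qed.

(** Strict total orders enter only through this property: parities of inversions are compared
    without transitivity. *)
Definition tournament (T : eqType) (r : rel T) :=
  irreflexive r /\ forall x y, x != y -> r x y = ~~ r y x.

Definition inversions (T : finType) (r r' : rel T) : 'F_2 :=
  \sum_x \sum_y (r x y && r' y x)%:R.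

Lemma tournament_pre (T U : eqType) (f : T -> U) (r : rel U) :
  injective f -> tournament r -> tournament (fun x y => r (f x) (f y)).
Proof.
move=> injf [irr tot]; split=> [x|x y neq]; first exact: irr.
by apply: tot; rewrite (inj_eq injf).
Qed.

Lemma tournament_ltn_on (T : eqType) (f : T -> nat) :
  injective f -> tournament (fun x y => f x < f y)%N.
Proof.
move=> injf; apply: (@tournament_pre _ _ f ltn) => //; split=> [x|x y neq] /=.
  by rewrite ltnn.
by case: ltngtP neq => // ->; rewrite eqxx.
Qed.

(** Off the diagonal the terms come in equal pairs, which cancel modulo 2; the enumeration order of
    [T] picks one term of each pair. *)
Lemma sum_sym0 (T : finType) (K : T -> T -> 'F_2) :
  (forall x, K x x = 0) -> (forall x y, K x y = K y x) -> \sum_x \sum_y K x y = 0.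
Proof.
move=> K0 Ksym; pose lt (x y : T) := (enum_rank x < enum_rank y)%N.
have /tournament_ltn_on [irr tot] : injective (fun x : T => enum_rank x : nat).
  by move=> x y /val_inj/enum_rank_inj.
have -> : \sum_x \sum_y K x y
    = \sum_x \sum_y (lt x y)%:R * K x y + \sum_x \sum_y (lt y x)%:R * K x y.
  rewrite -big_split; apply: eq_bigr => x _ /=; rewrite -big_split.
  apply: eq_bigr => y _ /=; rewrite -mulrDl; have [->|neq] := eqVneq x y.
    by rewrite K0 mulr0.
  by rewrite /lt tot // natF2_neg -addrA addF2 addr0 mul1r.
rewrite [X in _ + X]exchange_big /= -[RHS](addF2 (\sum_x \sum_y (lt x y)%:R * K x y)).
by congr (_ + _); apply: eq_bigr => x _; apply: eq_bigr => y _; rewrite Ksym.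
Qed.

Lemma tournament_sym (T : eqType) (r r' : rel T) x y : tournament r -> tournament r' ->
  (r x y)%:R + (r' x y)%:R = (r y x)%:R + (r' y x)%:R :> 'F_2.
Proof.
move=> [_ tr] [_ tr']; have [->//|neq] := eqVneq x y.
rewrite (tr x y) // (tr' x y) // !natF2_neg.
by rewrite addrACA addF2 add0r.
Qed.

(* Inversions are counted over unordered pairs, which any tournament [c] may enumerate. *)
Lemma invE (T : finType) (c r r' : rel T) : tournament c -> tournament r -> tournament r' ->
  inversions r r' = \sum_x \sum_y (c x y)%:R * ((r x y)%:R + (r' x y)%:R).
Proof.
move=> tc tr tr'; apply/eqP; rewrite -addF2_eq0; apply/eqP.
(* The two counts differ by the sum of this kernel, a product of sums of two tournaments; such sums
   are symmetric. *)
rewrite -[RHS](@sum_sym0 T (fun x y =>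
  ((r x y)%:R + (c x y)%:R) * ((r x y)%:R + (r' x y)%:R))); first last.
- by move=> x y; rewrite tournament_sym // [X in _ * X = _]tournament_sym.
- by move=> x; rewrite tc.1 tr.1 addF2 mul0r.
rewrite -big_split; apply: eq_bigr => x _ /=; rewrite -big_split.
apply: eq_bigr => y _ /=; rewrite mulrDl; congr (_ + _).
rewrite mulrDr natF2_and; have [->|neq] := eqVneq x y.
  by rewrite tr.1 !mul0r addr0.
by rewrite (tr'.2 y x) 1?eq_sym // natF2_neg mulrDr mulr1 mulF2.
Qed.

(** With the pairs enumerated by the common tournament [r1], the count is additive, because r1 + r3
    = (r1 + r2) + (r2 + r3) modulo 2. Intermediate orders are inserted by this rule. *)
Lemma inv_trans (T : finType) (r1 r2 r3 : rel T) :
  tournament r1 -> tournament r2 -> tournament r3 -> inversions r1 r3 = inversions r1 r2 + inversions r2 r3.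
Proof.
move=> t1 t2 t3; rewrite !(@invE _ r1) // -big_split; apply: eq_bigr => x _ /=.
rewrite -big_split; apply: eq_bigr => y _ /=; rewrite -mulrDr; congr (_ * _).
by rewrite -addrA addF2K.
Qed.

Lemma inv_sym (T : finType) (r1 r2 : rel T) : inversions r1 r2 = inversions r2 r1.
Proof.
by rewrite /inversions exchange_big; apply: eq_bigr => x _; apply: eq_bigr => y _; rewrite andbC.
Qed.

Lemma eq_inv (T : finType) (r1 r2 r1' r2' : rel T) :
  r1 =2 r1' -> r2 =2 r2' -> inversions r1 r2 = inversions r1' r2'.
Proof. by move=> e1 e2; apply: eq_bigr => x _; apply: eq_bigr => y _; rewrite e1 e2. Qed.

Lemma inv_reindex (S T : finType) (f : S -> T) (r r' : rel T) : bijective f ->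
  inversions (fun x y => r (f x) (f y)) (fun x y => r' (f x) (f y)) = inversions r r'.
Proof.
move=> bijf; rewrite /inversions (reindex f) /=; last exact: onW_bij.
by apply: eq_bigr => x _; rewrite [RHS](reindex f) //=; apply: onW_bij.
Qed.

Definition rel_perm (T : finType) (r : rel T) (p : {perm T}) : rel T :=
  fun x y => r (p x) (p y).

Lemma inv_tperm (T : finType) (r : rel T) x y : tournament r -> x != y ->
  inversions r (rel_perm r (tperm x y)) = 1.
Proof.
move=> tr neq.
(* The numbering [f] puts [x] first and [y] second. Pairs avoiding both are unaffected; for any
   other [t] the pairs (x,t) and (y,t) contribute equally and cancel; the pair (x,y) is left and
   contributes 1. *)
pose f t := if t == x then 0%N else if t == y then 1%N else (enum_rank t).+2.
have injf : injective f.
  move=> s t; rewrite /f.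
  case: (eqVneq s x) (eqVneq t x) => [->|_] [->|_] //; try by case: ifP.
  case: (eqVneq s y) (eqVneq t y) => [->|_] [->|_] //.
  by case=> /val_inj/enum_rank_inj.
rewrite (@invE _ (fun s t => f s < f t)%N) //; first last.
- exact/tournament_pre/tr/perm_inj.
- exact: tournament_ltn_on.
have fx : f x = 0%N by rewrite /f eqxx.
have fy : f y = 1%N by rewrite /f eq_sym (negPf neq) eqxx.
have f2 t : t != x -> t != y -> (1 < f t)%N by rewrite /f => /negPf-> /negPf->.
rewrite (bigD1 x) //= [X in _ + X](bigD1 y) 1?eq_sym //= [X in _ + (_ + X)]big1 ?addr0; last first.
  move=> s /andP[sx sy]; rewrite big1 // => t _; rewrite /rel_perm.
  rewrite (tpermD (z := s)) 1?eq_sym //.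
  have [->|tx] := eqVneq t x; first by rewrite fx mul0r.
  have [->|ty] := eqVneq t y; first by rewrite fy ltnS leqNgt (ltn_trans _ (f2 _ sx sy)) ?mul0r.
  by rewrite (tpermD (z := t)) 1?eq_sym // addF2 mulr0.
rewrite (bigD1 x) //= fx mul0r add0r (bigD1 y) 1?eq_sym //= fy mul1r.
rewrite [X in _ + X](bigD1 x) //= fx mul0r add0r [X in _ + X](bigD1 y) 1?eq_sym //= fy ltnn.
rewrite mul0r add0r -addrA -big_split big1 /= ?addr0 => [|t /andP[tx ty]].
  by rewrite /rel_perm tpermL tpermR (tr.2 _ _ neq) natF2_neg -addrA addF2 addr0.
have lt1 := f2 t tx ty.
rewrite lt1 (ltn_trans _ lt1) // !mul1r /rel_perm tpermL tpermR (tpermD (z := t)) 1?eq_sym //.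
by rewrite [X in _ + X]addrC addF2.
Qed.

(** Induction on a product of transpositions: [inv_trans] splits off the first one, and reindexing
    by it turns the rest into the induction hypothesis. *)
Lemma inv_perm (T : finType) (r : rel T) (p : {perm T}) : tournament r ->
  inversions r (rel_perm r p) = (p : bool)%:R.
Proof.
move=> tr; have tp (q : {perm T}) : tournament (rel_perm r q).
  exact/tournament_pre/tr/perm_inj.
have [ts -> dts] := prod_tpermP p; elim: ts dts => [_|t ts IHts] /=.
  rewrite big_nil odd_perm1; apply: big1 => x _; apply: big1 => y _.
  rewrite /rel_perm !perm1; have [->|neq] := eqVneq x y; first by rewrite tr.1.
  by rewrite (tr.2 _ _ neq) andNb.
case/andP=> dt /IHts {}IHts; rewrite big_cons odd_permM odd_tperm natF2_add.
set q := (\prod_(t <- ts) tperm t.1 t.2)%g in IHts *.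
rewrite (@inv_trans _ _ (rel_perm r (tperm t.1 t.2))) //.
rewrite inv_tperm // -IHts dt; congr (_ + _).
rewrite -(@inv_reindex _ _ (tperm t.1 t.2) r); last exact: injF_bij perm_inj.
by apply: eq_inv => x y; rewrite // /rel_perm !permM.
Qed.

(** * Linear algebra *)

(** The left kernel lies in the line spanned by the constant vector 1, so it has dimension at most
    one. *)
Lemma rank_ge_of_const_ker (F : fieldType) n m (A : 'M[F]_(n, m)) :
  (forall h : 'rV_n, h *m A = 0 -> exists c, h = const_mx c) -> (n <= \rank A + 1)%N.
Proof.
move=> hA; rewrite -leq_subLR -mxrank_ker.
apply: leq_trans (rank_leq_row (const_mx 1 : 'rV[F]_n)).
apply/mxrankS/row_subP => i.
have /hA [c ->] : row i (kermx A) *m A = 0 by rewrite -row_mul mulmx_ker row0.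
have -> : const_mx c = c *: const_mx 1 :> 'rV[F]_n by rewrite scalemx_const mulr1.
exact: scalemx_sub.
Qed.

(** Exactness by counting in a complex F -> E -> V. The ranks of [D] and [M] are at least |V| - 1
    and |F| - 1, so by Euler's relation the kernel of [D] has dimension at most |F| - 1, and the
    image of [M], which it contains, fills it. *)
Lemma exact_of_euler (K : fieldType) (V E F : finType) (D : E -> V -> K) (M : F -> E -> K) :
  (forall f v, \sum_e M f e * D e v = 0) ->
  (forall h : V -> K, (forall e, \sum_v D e v * h v = 0) -> forall u v, h u = h v) ->
  (forall h : F -> K, (forall e, \sum_f h f * M f e = 0) -> forall f g, h f = h g) ->
  (#|V| + #|F| = #|E| + 2)%N ->
  forall z : E -> K, (forall v, \sum_e z e * D e v = 0) ->
  exists y : F -> K, forall e, z e = \sum_f y f * M f e.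
Proof.
move=> MD0 hD hM euler z zD.
pose Dm : 'M[K]_(#|E|, #|V|) := \matrix_(i, j) D (enum_val i) (enum_val j).
pose Mm : 'M[K]_(#|F|, #|E|) := \matrix_(i, j) M (enum_val i) (enum_val j).
have const_of n (h : 'rV[K]_n) : (forall i j, h 0 i = h 0 j) -> exists c, h = const_mx c.
  case: n h => [|n] h hc; first by exists 0; apply/rowP=> -[].
  by exists (h 0 0); apply/rowP=> i; rewrite mxE.
have rD : (#|V| <= \rank Dm + 1)%N.
  rewrite -mxrank_tr; apply: rank_ge_of_const_ker => h h0; apply: const_of => i j.
  have := hD (fun v => h 0 (enum_rank v)) _ (enum_val i) (enum_val j).
  rewrite !enum_valK; apply=> e; move/rowP/(_ (enum_rank e)): h0; rewrite !mxE => {2}<-.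
  rewrite (reindex enum_rank) /=; last exact/onW_bij/enum_rank_bij.
  by apply: eq_bigr => v _; rewrite !mxE !enum_rankK mulrC.
have rM : (#|F| <= \rank Mm + 1)%N.
  apply: rank_ge_of_const_ker => h h0; apply: const_of => i j.
  have := hM (fun v => h 0 (enum_rank v)) _ (enum_val i) (enum_val j).
  rewrite !enum_valK; apply=> e; move/rowP/(_ (enum_rank e)): h0; rewrite !mxE => {2}<-.
  rewrite [RHS](reindex enum_rank) /=; last exact/onW_bij/enum_rank_bij.
  by apply: eq_bigr => v _; rewrite !mxE !enum_rankK.
have sMD : (Mm <= kermx Dm)%MS.
  apply/sub_kermxP/matrixP => i j; rewrite !mxE -[RHS](MD0 (enum_val i) (enum_val j)).
  rewrite (reindex enum_rank) /=; last exact/onW_bij/enum_rank_bij.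
  by apply: eq_bigr => v _; rewrite !mxE !enum_rankK.
have sDM : (kermx Dm <= Mm)%MS.
  rewrite -(geq_leqif (mxrank_leqif_sup sMD)) mxrank_ker leq_subLR.
  by move: (\rank Dm) (\rank Mm) rD rM euler => *; lia.
pose zm : 'rV[K]_#|E| := \row_i z (enum_val i).
have /submxP [y zy] : (zm <= Mm)%MS.
  apply: submx_trans sDM; apply/sub_kermxP/matrixP => i j; rewrite !mxE -[RHS](zD (enum_val j)).
  rewrite (reindex enum_rank) /=; last exact/onW_bij/enum_rank_bij.
  by apply: eq_bigr => v _; rewrite !mxE !enum_rankK.
exists (fun f => y 0 (enum_rank f)) => e; move/rowP/(_ (enum_rank e)): zy; rewrite !mxE enum_rankK => ->.
rewrite (reindex enum_rank) /=; last exact/onW_bij/enum_rank_bij.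
by apply: eq_bigr => v _; rewrite !mxE !enum_rankK.
Qed.

(** Sylvester's identity: [X *m A] and [A *m X] are both block lower triangular and have the same
    determinant. *)
Lemma det_addmulmx (R : comNzRingType) n k (U : 'M[R]_(n, k)) (V : 'M[R]_(k, n)) :
  \det (1%:M + U *m V) = \det (1%:M + V *m U).
Proof.
pose A := block_mx 1%:M (- U) V 1%:M; pose X := block_mx 1%:M U 0 1%:M.
have XA : \det (X *m A) = \det (1%:M + U *m V).
  rewrite mulmx_block !mul1mx mulmx1 !mul0mx addNr !add0r.
  by rewrite det_lblock det1 mulr1.
have AX : \det (A *m X) = \det (1%:M + V *m U).
  rewrite mulmx_block !mul1mx !mulmx1 !mulmx0 !addr0 subrr.
  by rewrite det_lblock det1 mul1r addrC.
by rewrite -XA -AX !det_mulmx mulrC.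
Qed.

Section BlockDiagonal.
Variables (R : comNzRingType) (I : finType) (p : I -> nat) (Phi : forall i, 'M[R]_(p i)).
Let S := {i : I & 'I_(p i)}.
Let H i : 'M[R]_(#|{: S}|, p i) :=
  \matrix_(s, k) (enum_val s == Tagged (fun i => 'I_(p i)) k)%:R.

Let neqS i j (k : 'I_(p i)) (l : 'I_(p j)) : i != j ->
  (Tagged (fun i => 'I_(p i)) k == Tagged (fun i => 'I_(p i)) l) = false.
Proof. by apply: contraNF => /eqP/(congr1 tag)/= ->. Qed.

Let HtH i : (H i)^T *m H i = 1%:M.
Proof.
apply/matrixP=> k l; rewrite !mxE (bigD1 (enum_rank (Tagged (fun i => 'I_(p i)) k))) //=.
rewrite !mxE enum_rankK eqxx mul1r big1 ?addr0 => [|s]; first by rewrite eq_Tagged.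
by rewrite !mxE -(inj_eq enum_val_inj) enum_rankK => /negPf->; rewrite mul0r.
Qed.

Let HtH0 i j : i != j -> (H i)^T *m H j = 0.
Proof.
move=> neq; apply/matrixP=> k l; rewrite !mxE big1 // => s _; rewrite !mxE.
case: eqP => [->|_]; last by rewrite mul0r.
by rewrite mul1r neqS.
Qed.

Let sumH (Psi : forall i, 'M[R]_(p i)) (G : S -> S -> R) :
  (forall i k l, G (Tagged _ k) (Tagged _ l) = Psi i k l) ->
  (forall s t, tag s != tag t -> G s t = 0) ->
  \matrix_(s, t) G (enum_val s) (enum_val t) = \sum_i H i *m Psi i *m (H i)^T.
Proof.
move=> GPsi G0; apply/matrixP=> s t; rewrite summxE mxE.
under eq_bigr => i _.
  rewrite mxE; under eq_bigr => l _.
    rewrite !mxE; under eq_bigr => k _ do rewrite mxE.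
    over.
  over.
move: (enum_val s) (enum_val t) => [i k] [j l].
rewrite (bigD1 i) //= [X in _ + X]big1 ?addr0; last first.
  move=> i' neq; rewrite big1 // => l' _; rewrite big1 ?mul0r // => k' _.
  by rewrite neqS ?mul0r // eq_sym.
have [e|neq] := eqVneq i j; last first.
  rewrite G0 // big1 // => l' _.
  by rewrite neqS ?mulr0 // eq_sym.
subst j; rewrite (bigD1 l) //= [X in _ + X]big1 ?addr0; last first.
  by move=> l' neq; rewrite eq_Tagged /= eq_sym (negPf neq) mulr0.
rewrite eqxx mulr1 (bigD1 k) //= big1 ?addr0; last first.
  by move=> k' neq; rewrite eq_Tagged /= eq_sym (negPf neq) mul0r.
by rewrite eqxx mul1r -GPsi.
Qed.

(** To avoid reading blocks off the enumeration of a sigma type, the matrix is written as 1 + sum of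
    C i, where C i = H i (Phi i - 1) (H i)^T and [H i] includes the [i]-th block. Distinct C i
    multiply to 0, so this is the product of the factors 1 + C i, and Sylvester's identity gives
    each factor the determinant of [Phi i]. *)
Lemma det_block_diag (G : S -> S -> R) :
  (forall i k l, G (Tagged _ k) (Tagged _ l) = Phi i k l) ->
  (forall s t, tag s != tag t -> G s t = 0) ->
  \det (\matrix_(s < #|{: S}|, t < #|{: S}|) G (enum_val s) (enum_val t)) = \prod_i \det (Phi i).
Proof.
move=> GPhi G0.
pose C i := H i *m (Phi i - 1%:M) *m (H i)^T.
have -> : \matrix_(s, t) G (enum_val s) (enum_val t) = 1%:M + \sum_i C i.
  have -> : 1%:M = \sum_i H i *m 1%:M *m (H i)^T.
    rewrite -(sumH (G := fun s t => (s == t)%:R)).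
    - by apply/matrixP=> s t; rewrite !mxE (inj_eq enum_val_inj).
    - by move=> i k l; rewrite eq_Tagged mxE.
    - by move=> s t; have [->|//] := eqVneq s t; rewrite eqxx.
  rewrite -big_split (sumH GPhi G0); apply: eq_bigr => i _ /=.
  by rewrite /C -mulmxDl -mulmxDr addrC subrK.
have HC i j : i != j -> C i *m C j = 0.
  by move=> neq; rewrite /C !mulmxA -(mulmxA _ _ (H j)) HtH0 // mulmx0 !mul0mx.
suff : forall r : seq I, uniq r -> \det (1%:M + \sum_(i <- r) C i) = \prod_(i <- r) \det (Phi i).
  by move/(_ (index_enum I) (index_enum_uniq _)).
elim=> [|i r IHr] /=; first by rewrite !big_nil addr0 det1.
case/andP=> ir /IHr {}IHr; rewrite !big_cons -IHr.
have -> : 1%:M + (C i + \sum_(j <- r) C j) = (1%:M + C i) *m (1%:M + \sum_(j <- r) C j).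
  rewrite mulmxDr mulmx1 mulmxDl mul1mx mulmx_sumr addrA.
  rewrite [X in _ = _ + (_ + X)]big_seq [X in _ = _ + (_ + X)]big1 ?addr0 // => j jr.
  by apply: HC; apply: contraNneq ir => ->.
rewrite det_mulmx; congr (_ * _).
by rewrite /C -mulmxA det_addmulmx -mulmxA HtH mulmx1 addrC subrK.
Qed.
End BlockDiagonal.

(** Each reordering has as sign the inversions against the standard order of ['I_n], and [inv_trans]
    merges the two signs into one comparison of [f] with [g]. *)
Lemma det_mxsub_inv (R : comNzRingType) n (A : 'M[R]_n) (f g : 'I_n -> 'I_n) :
  injective f -> injective g ->
  \det A = sg R (inversions (fun i j => f i < f j)%N (fun i j => g i < g j)%N) * \det (mxsub f g A).
Proof.
move=> injf injg.
have tlt : tournament (fun i j : 'I_n => i < j)%N by apply/tournament_ltn_on/val_inj.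
have sgE (h : 'I_n -> 'I_n) (injh : injective h) :
    inversions (fun i j : 'I_n => i < j)%N (fun i j => h i < h j)%N = (perm injh : bool)%:R.
  by rewrite -(inv_perm _ tlt); apply: eq_inv => // i j; rewrite /rel_perm !permE.
rewrite (inv_trans (r2 := fun i j : 'I_n => i < j)%N) //; first last.
- exact: (tournament_pre injg tlt).
- exact: (tournament_pre injf tlt).
rewrite inv_sym (sgE f injf) (sgE g injg) sgD !sg_nat.
have -> : mxsub f g A = row_perm (perm injf) (col_perm (perm injg) A).
  by apply/matrixP=> i j; rewrite !mxE !permE.
rewrite row_permE col_permE !det_mulmx !det_perm odd_permV.
by rewrite mulrACA (mulrCA _ (\det A)) -!expr2 !sqrr_sign mul1r mulr1.
Qed.

Lemma sqdet_mxsub (R : realFieldType) n p q (A : 'M[R]_(p, q)) (f : 'I_n -> 'I_p) (g : 'I_n -> 'I_q) :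
  p = n -> q = n -> injective f -> injective g ->
  sqdet A = sg R (inversions (fun i j => f i < f j)%N (fun i j => g i < g j)%N) * \det (mxsub f g A).
Proof.
move=> ep eq; subst p q; rewrite /sqdet conform_mx_id; exact: det_mxsub_inv.
Qed.

(** * Edge orders and signs of lists *)

Lemma index_orbit_step (T : finType) (f : T -> T) c w u :
  injective f -> fconnect f c w -> fconnect f c u ->
  (index w (fingraph.orbit f (f c)) < index u (fingraph.orbit f (f c)))%N
    (+) (index (f w) (fingraph.orbit f (f c)) < index u (fingraph.orbit f (f c)))%N
  = (u == f w) (+) (w == c).
Proof.
move=> injf; rewrite !(same_fconnect1 injf c) => cw cu.
rewrite -![index _ _]/(findex f (f c) _).
have ltw := findex_max cw; have ltu := findex_max cu.
have fcw : fconnect f (f c) (f w) by rewrite -same_fconnect1_r.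
have -> : (u == f w) = (findex f (f c) u == findex f (f c) (f w)).
  by apply/eqP/eqP=> [->//|e]; rewrite -(iter_findex cu) -(iter_findex fcw) e.
have -> : (w == c) = ((findex f (f c) w).+1 == fingraph.order f (f c)).
  rewrite -(inj_eq injf) -{1}(iter_findex cw) -iterS.
  apply/eqP/eqP=> [e|->]; last by rewrite iter_order.
  apply/eqP; rewrite eqn_leq ltw leqNgt; apply/negP=> lt.
  by move: (findex_iter lt); rewrite e findex0.
have -> : findex f (f c) (f w) = if (findex f (f c) w).+1 == fingraph.order f (f c) then 0%N
    else (findex f (f c) w).+1.
  rewrite -{1}(iter_findex cw) -iterS; case: eqP => [->|neq]; first by rewrite iter_order ?findex0.
  by rewrite findex_iter // ltn_neqAle ltw; apply/andP; split=> //; apply/eqP.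
move: (findex _ _ w) (findex _ _ u) (fingraph.order _ _) ltw ltu => i j n.
by case: eqP => *; lia.
Qed.

Lemma map_iter_orbit (T : finType) (f : T -> T) x n : n = fingraph.order f x ->
  [seq iter k f x | k <- iota 0 n] = fingraph.orbit f x.
Proof.
move=> ->; rewrite /fingraph.orbit; apply: (@eq_from_nth _ x) => [|i].
  by rewrite size_map size_iota size_traject.
rewrite size_map size_iota => lt.
by rewrite (nth_map 0%N) ?size_iota // nth_traject // nth_iota.
Qed.

Lemma index_enum_ord n (A : {set 'I_n}) i j : i \in A -> j \in A ->
  (index i (enum A) < index j (enum A))%N = (i < j)%N.
Proof.
have srt : sorted (fun i j : 'I_n => i < j)%N (enum A).
  rewrite {1}/enum_mem; apply: sorted_filter; first by move=> ? ? ?; apply: ltn_trans.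
  by rewrite -enumT -[sorted _ _](@sorted_map _ _ val ltn) val_enum_ord iota_ltn_sorted.
have lt x y : x \in A -> y \in A -> (index x (enum A) < index y (enum A))%N -> (x < y)%N.
  move=> xA yA; apply: (sorted_ltn_index _ srt); rewrite ?mem_enum //.
  by move=> ? ? ?; apply: ltn_trans.
move=> iA jA; apply/idP/idP; first exact: lt.
move=> ltij; rewrite ltnNge leq_eqVlt; apply/negP => /orP[/eqP e|/lt].
  suff eji : j = i by rewrite eji ltnn in ltij.
  by rewrite -(@nth_index _ j j (enum A)) ?mem_enum // e nth_index ?mem_enum.
by move=> /(_ jA iA); rewrite ltnNge ltnW.
Qed.

Lemma ltn_enum_val n (A : {set 'I_n}) (i j : 'I_#|A|) :
  (enum_val i < enum_val j)%N = (i < j)%N.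
Proof.
rewrite -(@index_enum_ord _ A) ?enum_valP // !(enum_val_nth (enum_default i)) !index_uniq ?enum_uniq //;
  by rewrite -cardE.
Qed.

(** The sum has one term, the permutation read off [s]. Positions in [s] give its inverse, which has
    the same signature. *)
Lemma sign_of_list_inv (R : realFieldType) n (s : seq nat) : perm_eq s (iota 0 n) ->
  sign_of_list R n s =
    sg R (inversions (fun i j : 'I_n => i < j)%N (fun i j : 'I_n => index (val i) s < index (val j) s)%N).
Proof.
move=> ps; have us : uniq s by rewrite (perm_uniq ps) iota_uniq.
have szs : size s = n by rewrite (perm_size ps) size_iota.
have ms x : (x \in s) = (x < n)%N by rewrite (perm_mem ps) mem_iota.
have lt_nth (k : 'I_n) : (nth 0%N s k < n)%N by rewrite -ms mem_nth ?szs.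
pose f k := Ordinal (lt_nth k).
have injf : injective f.
  move=> i j /(congr1 val)/= /eqP; rewrite nth_uniq ?szs // => /eqP; exact: val_inj.
have idx i : index (val i) s = ((perm injf)^-1)%g i.
  rewrite -{1}(permKV (perm injf) i) permE /= index_uniq ?szs //.
rewrite /sign_of_list (big_pred1 (perm injf)) => [|p] /=.
  rewrite -odd_permV -sg_nat -(@inv_perm _ (fun i j : 'I_n => i < j)%N); last first.
    exact/tournament_ltn_on/val_inj.
  by congr sg; apply: eq_inv => // i j; rewrite !idx.
apply/forallP/eqP=> [e|-> k]; last by rewrite permE.
by apply/permP=> k; apply: val_inj; rewrite permE /=; apply/eqP.
Qed.

Section ListByColor.
Variables (n : nat) (W : eqType) (col : 'I_n -> W).
Let A w := [set i | col i == w].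
Let block w := sort leq [seq val i | i <- enum (A w)].

Let flattenE ord :
  flatten [seq block w | w <- ord] = map val (flatten [seq enum (A w) | w <- ord]).
Proof.
elim: ord => //= w ord ->; rewrite map_cat; congr (_ ++ _).
rewrite /block sorted_sort //; first exact: leq_trans.
rewrite sorted_map {1}/enum_mem; apply: sorted_filter => [x y z|]; first exact: leq_trans.
by rewrite -enumT -[sorted _ _](@sorted_map _ _ val leq) val_enum_ord iota_sorted.
Qed.

Lemma index_flatten_blocks (ord : seq W) i j : col i \in ord -> col j \in ord ->
  (index (val i) (flatten [seq block w | w <- ord])
   < index (val j) (flatten [seq block w | w <- ord]))%N
  = (index (col i) ord < index (col j) ord)%N || (col i == col j) && (i < j)%N.
Proof.
rewrite flattenE !(index_map val_inj).
elim: ord => //= w ord IH; rewrite !index_cat !mem_enum !(inE, in_set).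
rewrite !(eq_sym w).
have [ei|ni] := eqVneq (col i) w; have [ej|nj] := eqVneq (col j) w => /=.
- by rewrite index_enum_ord ?inE ?ei ?ej ?eqxx.
- by move=> _ _; rewrite ltn_addr // index_mem mem_enum inE ei.
- move=> _ _; rewrite ej (negPf ni) /= ltnNge ltnW // ltn_addr //.
  by rewrite index_mem mem_enum inE ej.
by rewrite ltn_add2l => hi hj; rewrite IH // !ltnS.
Qed.

Lemma perm_flatten_blocks (ord : seq W) : uniq ord -> (forall i, col i \in ord) ->
  perm_eq (flatten [seq block w | w <- ord]) (iota 0 n).
Proof.
move=> uo co; rewrite flattenE -val_enum_ord perm_map //; apply: uniq_perm.
- elim: ord uo {co} => //= w ord IH /andP[wo uo]; rewrite cat_uniq enum_uniq IH // andbT.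
  apply/hasPn=> i /flattenP[_ /mapP[w' w'o ->]]; rewrite !mem_enum !inE => /eqP e.
  by apply: contraNN wo => /eqP<-; rewrite e.
- exact: enum_uniq.
move=> i; rewrite mem_enum; apply/flattenP; exists (enum (A (col i))).
  exact: map_f.
by rewrite mem_enum inE.
Qed.

(** The common form of c_b and c_w: the colors at a vertex in increasing order, compared with their
    order by edge first and color second. *)
Lemma sign_of_flatten_blocks (R : realFieldType) (ord : seq W) :
  uniq ord -> (forall i, col i \in ord) ->
  sign_of_list R n (flatten [seq block w | w <- ord]) =
  sg R (inversions (fun i j : 'I_n => i < j)%N (fun i j : 'I_n =>
    (index (col i) ord < index (col j) ord)%N || (col i == col j) && (i < j)%N)).
Proof.
move=> uo co; rewrite sign_of_list_inv ?perm_flatten_blocks //.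
by congr sg; apply: eq_inv => // i j; rewrite index_flatten_blocks.
Qed.
End ListByColor.

(** * The inversion form *)

Section InversionForm.
Variables (E : finType) (r r' : rel E).
Hypotheses (tr : tournament r) (tr' : tournament r').
Implicit Types m z : {ffun E -> 'F_2}.

(** Inversions between the two orders on strands, with [m p] parallel strands on each edge [p].
    Parallel strands are never inverted with each other. *)
Definition inv_form m : 'F_2 := \sum_p \sum_q m p * m q * (r p q && r' q p)%:R.

(** The polar form of [inv_form]; its kernel marks the pairs on which [r] and [r'] disagree. *)
Definition inv_polar m z : 'F_2 := \sum_p \sum_q m p * z q * ((r q p)%:R + (r' q p)%:R).

Lemma inv_formD m z : inv_form (m + z) = inv_form m + inv_form z + inv_polar m z.
Proof.
(* [J] is symmetric and zero on the diagonal. Elsewhere exactly one of [r p q] and [r q p] holds, so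
   the two cross terms add up to an unrestricted double sum. *)
pose J p q : 'F_2 := (r p q)%:R + (r' p q)%:R.
have formE (u : {ffun E -> 'F_2}) : inv_form u = \sum_p \sum_q u p * u q * ((r p q)%:R * J p q).
  apply: eq_bigr => p _; apply: eq_bigr => q _; congr (_ * _).
  rewrite mulrDr natF2_and mulF2; have [->|neq] := eqVneq p q.
    by rewrite tr.1 !mul0r addr0.
  by rewrite (tr'.2 q p) 1?eq_sym // natF2_neg mulrDr mulr1.
have Jsym p q : J p q = J q p by apply: tournament_sym.
have -> : inv_polar m z = \sum_p \sum_q m p * z q * ((r p q)%:R * J p q)
    + \sum_p \sum_q z p * m q * ((r p q)%:R * J p q).
  rewrite [X in _ = _ + X]exchange_big -big_split; apply: eq_bigr => p _ /=.
  rewrite -big_split; apply: eq_bigr => q _ /=.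
  rewrite (mulrC (z q)) -mulrDr; congr (_ * _).
  rewrite (Jsym q p) -mulrDl -/(J q p) Jsym; have [->|neq] := eqVneq p q.
    by rewrite /J tr.1 tr'.1 !addr0 mul0r.
  by rewrite (tr.2 p q) // natF2_neg -addrA addF2 addr0 mul1r.
rewrite !formE -!big_split; apply: eq_bigr => p _ /=; rewrite -!big_split.
by apply: eq_bigr => q _ /=; rewrite !ffunE; ring.
Qed.

Lemma inv_polarD m z z' : inv_polar m (z + z') = inv_polar m z + inv_polar m z'.
Proof.
rewrite -big_split; apply: eq_bigr => p _ /=; rewrite -big_split.
by apply: eq_bigr => q _ /=; rewrite ffunE; ring.
Qed.

(** The polar form of a quadratic form over ['F_2] is alternating: expand the form at m + m = 0. *)
Lemma inv_polar_self m : inv_polar m m = 0.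
Proof.
have := inv_formD m m; rewrite addF2 add0r => <-.
rewrite (_ : m + m = 0); last by apply/ffunP=> p; rewrite !ffunE addF2.
by apply: big1 => p _; apply: big1 => q _; rewrite ffunE !mul0r.
Qed.

End InversionForm.

(** * Corner contributions on one side of the bipartition *)

Section Side.
Variables (B W : finType) (pos : B -> W -> nat).

(** Edges are compared by their endpoint on one side, then by position at that endpoint. The
    arguments are separate so that the white side can use the same section with the roles
    exchanged. *)
Definition lexlt (b : B) (w : W) (b' : B) (u : W) : bool :=
  (enum_rank b < enum_rank b')%N || (b == b') && (pos b w < pos b' u)%N.

Lemma tournament_lexlt : (forall b, injective (pos b)) ->
  tournament (fun p q : B * W => lexlt p.1 p.2 q.1 q.2).
Proof.
move=> injp; split=> [[b w]|[b w] [b' w']] /=; first by rewrite /lexlt !ltnn andbF.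
rewrite /lexlt; have [<-{b'}|neq] := eqVneq b b' => /=.
  rewrite ltnn => neq; have {}neq : w != w' by apply: contraNneq neq => ->.
  exact: (tournament_ltn_on (injp b)).2.
by move=> _; rewrite !orbF; apply: (tournament_ltn_on (inj_comp val_inj enum_rank_inj)).2.
Qed.

Variables (adj : B -> W -> bool) (s : B -> {perm W}) (t : B -> W -> W) (cil : B -> W).
Variables (c1 c2 m : B -> W -> 'F_2).
Hypothesis c2s : forall b w, c2 b (s b w) = c1 b w.
Hypothesis c1_adj : forall b w, ~~ adj b w -> c1 b w = 0.
Hypothesis m_adj : forall b w, ~~ adj b w -> m b w = 0.
Hypothesis pos_step : forall b w u, adj b w -> adj b u ->
  (pos b w < pos b u)%N (+) (pos b (s b w) < pos b u)%N = (u == t b w) (+) (w == cil b).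

(* The entering dart [(b, w)] and the leaving dart [(b, s b w)] of the same corner cancel
   except for edges at [b] itself, where [pos_step] leaves one edge and the cilium. *)
Lemma side_sum :
  \sum_b' \sum_u m b' u * (\sum_b \sum_w (c1 b w + c2 b w) * (lexlt b w b' u)%:R)
  = \sum_b \sum_w c1 b w * m b (t b w) + \sum_b c1 b (cil b) * \sum_u m b u.
Proof.
rewrite -big_split; apply: eq_bigr => b' _ /=.
transitivity (\sum_u m b' u * \sum_w c1 b' w * ((u == t b' w)%:R + (w == cil b')%:R)).
  apply: eq_bigr => u _; have [au|nau] := boolP (adj b' u); last by rewrite m_adj // !mul0r.
  congr (_ * _); rewrite (bigD1 b') //= [X in _ + X]big1 ?addr0 => [|b neq]; last first.
    rewrite /lexlt (negPf neq) /= orbF -mulr_suml; apply/eqP; rewrite mulf_eq0.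
    rewrite big_split /= [X in _ + X](reindex_inj (@perm_inj _ (s b))) /=.
    by under [X in _ + X]eq_bigr do rewrite c2s; rewrite addF2 eqxx.
  under eq_bigr do rewrite mulrDl; rewrite big_split /=.
  rewrite [X in _ + X](reindex_inj (@perm_inj _ (s b'))) -big_split; apply: eq_bigr => w _ /=.
  rewrite c2s -mulrDr; have [aw|naw] := boolP (adj b' w); last by rewrite c1_adj // !mul0r.
  by rewrite /lexlt ltnn eqxx /= -!natF2_add pos_step.
under [LHS]eq_bigr do rewrite mulr_sumr; rewrite exchange_big /=.
under [LHS]eq_bigr => w _.
  under eq_bigr do rewrite mulrCA; rewrite -mulr_sumr.
  under eq_bigr do rewrite mulrDr; rewrite big_split /= mulrDr.
  over.
rewrite big_split /=; congr (_ + _).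
  apply: eq_bigr => w _; rewrite (bigD1 (t b' w)) //= eqxx mulr1 big1 ?addr0 // => u /negPf->.
  by rewrite mulr0.
rewrite (bigD1 (cil b')) //= eqxx [X in _ + X]big1 ?addr0 => [|w /negPf->].
  by under eq_bigr do rewrite mulr1.
by under eq_bigr do rewrite mulr0; rewrite big1 // mulr0.
Qed.
End Side.

(** * Faces *)

Lemma closed_rotation (T : finType) (s : {perm T}) (a : pred T) x :
  (forall y, ~~ a y -> s y = y) -> a (s x) = a x.
Proof.
move=> fixs; apply/idP/idP; last by apply: contraLR => /[dup] /fixs /perm_inj ->.
by apply: contraLR => nax; rewrite fixs.
Qed.

Lemma fconnect_rotation (T : finType) (s : {perm T}) (a : pred T) x y :
  (forall y, ~~ a y -> s y = y) -> (forall x y, a x -> a y -> fconnect s x y) ->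
  a x -> fconnect s x y = a y.
Proof.
move=> fixs cyc ax; apply/idP/idP; last exact: cyc.
move=> cxy; rewrite -(@fconnect_invariant _ s _ a _ x y) // => z.
by rewrite /invariant /= (closed_rotation _ fixs) eqxx.
Qed.

Lemma fconnect_permV (T : finType) (s : {perm T}) : fconnect s^-1%g =2 fconnect s.
Proof.
move=> x y; rewrite -(same_fconnect_finv (@perm_inj _ s)); apply: eq_connect => u v /=.
congr (_ == _); apply: (@perm_inj _ s); rewrite permKV f_finv //; exact: perm_inj.
Qed.

Lemma big_pair (R : Type) (idx : R) (op : Monoid.com_law idx) (I J : finType) (F : I * J -> R) :
  \big[op/idx]_p F p = \big[op/idx]_i \big[op/idx]_j F (i, j).
Proof. by rewrite pair_bigA; apply: eq_bigr => -[]. Qed.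

Lemma sum_indicator_sig (T : finType) (P : pred T) (G : T -> 'F_2) :
  \sum_p (P p)%:R * G p = \sum_(t : {p | P p}) G (val t).
Proof.
transitivity (\sum_(p | P p) G p).
  by rewrite [RHS]big_mkcond; apply: eq_bigr => p _; case: (P p); rewrite ?mul1r ?mul0r.
rewrite (reindex_omap (val : {p | P p} -> T) insub) => [|p Pp]; last by rewrite insubT.
by apply: eq_bigl => -[p Pp] /=; rewrite insubT Pp /= eqxx.
Qed.

Section Plane.
Variables (B W : finType) (adj : B -> W -> bool).
Variables (sB : B -> {perm W}) (sW : W -> {perm B}).
Variables (cB : B -> W) (cW : W -> B).
Hypothesis rot : rotation_system adj sB sW.

Local Notation fphi := (fphi sB sW).
Local Notation is_dart := (is_dart adj).

Lemma adj_sB b w : adj b (sB b w) = adj b w.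
Proof. by case: rot => fB _ _ _; apply: (@closed_rotation _ (sB b) (adj b)) => y; apply: fB. Qed.

Lemma adj_sW w b : adj (sW w b) w = adj b w.
Proof. by case: rot => _ _ fW _; apply: (@closed_rotation _ (sW w) (adj^~ w)) => y; apply: fW. Qed.

Lemma fphi_inj : injective fphi.
Proof.
by move=> [[b w] []] [[b' w'] []] //= [] => [+ ew|->]; rewrite -?ew => /perm_inj->.
Qed.

Lemma is_dart_fphi d : is_dart (fphi d) = is_dart d.
Proof. by case: d => [[b w] []]; rewrite /Defs.is_dart /= ?adj_sB ?adj_sW. Qed.

Lemma is_dart_fconnect d d' : fconnect fphi d d' -> is_dart d = is_dart d'.
Proof.
apply: (@fconnect_invariant _ fphi _ is_dart) => x.
by rewrite /invariant /= is_dart_fphi eqxx.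
Qed.

Lemma edge_order_B_orbit b : adj b (cB b) ->
  edge_order_B adj sB cB b = fingraph.orbit (sB b) (sB b (cB b)).
Proof.
case: rot => fB cycB _ _ acb; rewrite -(map_iter_orbit (n := degB adj b)).
  by apply: eq_map => k; apply: iterSr.
apply: eq_card => w; rewrite [RHS]inE -same_fconnect1; last exact: perm_inj.
by rewrite (fconnect_rotation _ _ _ acb) //; [apply: fB | apply: cycB].
Qed.

Lemma edge_order_W_orbit w : adj (cW w) w ->
  edge_order_W adj sW cW w = fingraph.orbit (sW w)^-1%g (cW w).
Proof.
case: rot => _ _ fW cycW acw; rewrite -(map_iter_orbit (n := degW adj w)) //.
apply: eq_card => b; rewrite [RHS]inE.
rewrite fconnect_permV.
by rewrite (@fconnect_rotation _ (sW w) (adj^~ w)) //; [move=> y; apply: fW | apply: cycW].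
Qed.

(* Appending [enum] makes the position injective on non-neighbours as well. *)
Definition posB b w := index w (edge_order_B adj sB cB b ++ enum W).
Definition posW w b := index b (edge_order_W adj sW cW w ++ enum B).

Lemma posB_inj b : injective (posB b).
Proof.
move=> w w' e; rewrite -(@nth_index _ w w (edge_order_B adj sB cB b ++ enum W)).
  by rewrite -/(posB b w) e nth_index // mem_cat mem_enum orbT.
by rewrite mem_cat mem_enum orbT.
Qed.

Lemma posW_inj w : injective (posW w).
Proof.
move=> b b' e; rewrite -(@nth_index _ b b (edge_order_W adj sW cW w ++ enum B)).
  by rewrite -/(posW w b) e nth_index // mem_cat mem_enum orbT.
by rewrite mem_cat mem_enum orbT.
Qed.

Hypothesis cil : cilia_ok adj cB cW.

Lemma adj_cB b w : adj b w -> adj b (cB b).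
Proof. by move=> a; apply: cil.1; apply/existsP; exists (inr w). Qed.

Lemma adj_cW b w : adj b w -> adj (cW w) w.
Proof. by move=> a; apply: cil.2; apply/existsP; exists (inl b). Qed.

Lemma fconnect_sB b w u : adj b w -> adj b u -> fconnect (sB b) w u.
Proof. by case: rot => _ h _ _; apply: h. Qed.

Lemma fconnect_sW w b u : adj b w -> adj u w -> fconnect (sW w)^-1%g b u.
Proof.
by case: rot => _ _ _ h; rewrite fconnect_permV; apply: h.
Qed.

Lemma mem_edge_order_B b w : adj b w -> w \in edge_order_B adj sB cB b.
Proof.
move=> a; have ac := adj_cB a; rewrite edge_order_B_orbit // -fconnect_orbit.
by rewrite fconnect_sB ?adj_sB.
Qed.

Lemma mem_edge_order_W b w : adj b w -> b \in edge_order_W adj sW cW w.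
Proof.
move=> a; have ac := adj_cW a; rewrite edge_order_W_orbit // -fconnect_orbit.
by rewrite fconnect_sW.
Qed.

Lemma uniq_edge_order_B b : uniq (edge_order_B adj sB cB b).
Proof.
have [ac|nac] := boolP (adj b (cB b)); first by rewrite edge_order_B_orbit // orbit_uniq.
rewrite /edge_order_B (_ : degB adj b = 0%N) //; apply: eq_card0 => w.
by apply: contraNF nac => /adj_cB.
Qed.

Lemma uniq_edge_order_W w : uniq (edge_order_W adj sW cW w).
Proof.
have [ac|nac] := boolP (adj (cW w) w); first by rewrite edge_order_W_orbit // orbit_uniq.
rewrite /edge_order_W (_ : degW adj w = 0%N) //; apply: eq_card0 => b.
by apply: contraNF nac => /adj_cW.
Qed.

Lemma posBE b w : adj b w -> posB b w = index w (edge_order_B adj sB cB b).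
Proof. by move=> a; rewrite /posB index_cat mem_edge_order_B. Qed.

Lemma posWE b w : adj b w -> posW w b = index b (edge_order_W adj sW cW w).
Proof. by move=> a; rewrite /posW index_cat mem_edge_order_W. Qed.

Lemma posB_step b w u : adj b w -> adj b u ->
  (posB b w < posB b u)%N (+) (posB b (sB b w) < posB b u)%N = (u == sB b w) (+) (w == cB b).
Proof.
move=> aw au; have ac := adj_cB aw.
rewrite !posBE ?adj_sB // edge_order_B_orbit // index_orbit_step ?fconnect_sB //.
exact: perm_inj.
Qed.

(** White edge orders are clockwise, so a step of the face is a step of the inverse rotation taken
    backwards. The edge left over is therefore [b] itself, whereas at a black vertex it is the
    successor [sB b w]. *)
Lemma posW_step w b u : adj b w -> adj u w ->
  (posW w b < posW w u)%N (+) (posW w (sW w b) < posW w u)%N = (u == b) (+) (b == cW w).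
Proof.
move=> ab au; have ac := adj_cW ab.
rewrite !posWE ?adj_sW // edge_order_W_orbit //.
have := @index_orbit_step _ (sW w)^-1%g (sW w (cW w)) (sW w b) u (@perm_inj _ _).
rewrite !permK (inj_eq perm_inj) addbC; apply; by rewrite fconnect_sW ?adj_sW.
Qed.

Definition elB (p q : B * W) := lexlt posB p.1 p.2 q.1 q.2.
Definition elW (p q : B * W) := lexlt posW p.2 p.1 q.2 q.1.

Lemma tournament_elB : tournament elB.
Proof. exact/tournament_lexlt/posB_inj. Qed.

Lemma tournament_elW : tournament elW.
Proof.
apply: (@tournament_pre _ _ (fun p : B * W => (p.2, p.1)) _ _ (tournament_lexlt posW_inj)).
by case=> b w [b' w'] [-> ->].
Qed.

Local Notation form := (inv_form elB elW).
Local Notation polar := (inv_polar elB elW).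

Definition on_face (d : dart B W) (b : B) (w : W) (dir : bool) : 'F_2 :=
  (fconnect fphi d (b, w, dir))%:R.

(** The mod 2 boundary of the face; an edge with the face on both sides gets 0. *)
Definition face_chain (d : dart B W) : {ffun B * W -> 'F_2} :=
  [ffun p => on_face d p.1 p.2 true + on_face d p.1 p.2 false].

Lemma on_face_sB d b w : on_face d b (sB b w) true = on_face d b w false.
Proof. by rewrite /on_face (same_fconnect1_r fphi_inj d (b, w, false)). Qed.

Lemma on_face_sW d b w : on_face d (sW w b) w false = on_face d b w true.
Proof. by rewrite /on_face (same_fconnect1_r fphi_inj d (b, w, true)). Qed.

Lemma on_face_adj d b w dir : is_dart d -> ~~ adj b w -> on_face d b w dir = 0.
Proof.
move=> dd; rewrite /on_face; case: (boolP (fconnect _ _ _)) => // /is_dart_fconnect.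
by rewrite dd /Defs.is_dart /= => <-.
Qed.

(** [side_sum] is applied on the black and on the white side. The edges left over are, on both
    sides, those which the face traverses from black to white; their contributions cancel, and only
    the cilia remain. *)
Lemma polar_face d (m : {ffun B * W -> 'F_2}) : is_dart d ->
  (forall b w, ~~ adj b w -> m (b, w) = 0) ->
  polar m (face_chain d) = \sum_b on_face d b (cB b) false * \sum_w m (b, w)
    + \sum_w on_face d (cW w) w true * \sum_b m (b, w).
Proof.
move=> dd madj.
have HB := @side_sum _ _ posB adj sB sB cB (fun b w => on_face d b w false)
  (fun b w => on_face d b w true) (fun b w => m (b, w)) (on_face_sB d)
  (fun b w => @on_face_adj d b w false dd) madj posB_step.
have HW := @side_sum _ _ posW (fun w b => adj b w) sW (fun _ b => b) cW
  (fun w b => on_face d b w true) (fun w b => on_face d b w false) (fun w b => m (b, w))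
  (fun w b => on_face_sW d b w) (fun w b => @on_face_adj d b w true dd)
  (fun w b => madj b w) posW_step.
have eqs : \sum_b \sum_w on_face d b w false * m (b, sB b w)
    = \sum_w \sum_b on_face d b w true * m (b, w).
  rewrite [RHS]exchange_big; apply: eq_bigr => b _ /=.
  rewrite [RHS](reindex_inj (@perm_inj _ (sB b))).
  by apply: eq_bigr => w _; rewrite on_face_sB.
rewrite eqs in HB.
have -> : polar m (face_chain d) =
    \sum_b' \sum_u m (b', u) *
      (\sum_b \sum_w (on_face d b w false + on_face d b w true) * (lexlt posB b w b' u)%:R) +
    \sum_u \sum_b' m (b', u) *
      (\sum_w \sum_b (on_face d b w true + on_face d b w false) * (lexlt posW w b u b')%:R).
  rewrite [X in _ = _ + X]exchange_big !pair_bigA -big_split; apply: eq_bigr => -[b' u] _ /=.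
  rewrite -mulrDr; under eq_bigr do rewrite -mulrA; rewrite -mulr_sumr; congr (_ * _).
  rewrite [X in _ = _ + X]exchange_big !pair_bigA -big_split; apply: eq_bigr => -[b w] _ /=.
  rewrite ffunE /= mulrDr; congr (_ * _ + _ * _).
  exact: addrC.
by rewrite HB HW addrACA addF2 add0r.
Qed.

Lemma sum_on_face_false d (G : B * W -> 'F_2) :
  \sum_p on_face d p.1 p.2 false * G p
  = \sum_p on_face d p.1 p.2 true * G (sW p.2 p.1, p.2).
Proof.
rewrite !big_pair exchange_big [RHS]exchange_big; apply: eq_bigr => w _ /=.
rewrite (reindex_inj (@perm_inj _ (sW w))); apply: eq_bigr => b _.
by rewrite on_face_sW.
Qed.

(** Directions alternate along the face, so half of its darts run from black to white. *)
Lemma card_face d :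
  (fingraph.order fphi d = (#|[pred p | fconnect fphi d (p, true)]|).*2)%N.
Proof.
rewrite /fingraph.order -sum1_card /= big_mkcond /=.
rewrite big_pair /=; under eq_bigr do rewrite big_bool; rewrite big_split /= -addnn.
rewrite -!sum1_card [in RHS]big_mkcond /=; congr (_ + _)%N.
rewrite !big_pair exchange_big [RHS]exchange_big; apply: eq_bigr => w _ /=.
rewrite (reindex_inj (@perm_inj _ (sW w))); apply: eq_bigr => b _ /=.
by rewrite [in RHS]inE (same_fconnect1_r fphi_inj d (b, w, true)).
Qed.

(** * The inversion form at the boundary of a simple face *)

Section SimpleFace.
Variable d : dart B W.
Hypothesis dd : is_dart d.
Hypothesis simple : {in fconnect fphi d &, injective (@head B W)}.

(** Simplicity concerns the heads of darts. A dart leaving [b] is preceded on the face by a dart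
    with head [b], to which it applies. *)
Lemma face_uniq_B b w w' :
  fconnect fphi d (b, w, true) -> fconnect fphi d (b, w', true) -> w = w'.
Proof.
have pre u : fconnect fphi d (b, u, true) -> fconnect fphi d (b, (sB b)^-1%g u, false).
  by rewrite (same_fconnect1_r fphi_inj d (b, (sB b)^-1%g u, false)) /= permKV.
move=> /pre h /pre h'; apply: (@perm_inj _ (sB b)^-1%g).
by have [] : (b, (sB b)^-1%g w, false) = (b, (sB b)^-1%g w', false) by apply: simple.
Qed.

Lemma face_uniq_W b b' w :
  fconnect fphi d (b, w, true) -> fconnect fphi d (b', w, true) -> b = b'.
Proof. by move=> h h'; have [] : (b, w, true) = (b', w, true) by apply: simple. Qed.

(** The edges traversed from black to white form a perfect matching of the face. From such an edge,
    [half_turn] leads to the next edge of the face and [turn] to the one after, which is in the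
    matching again. *)
Let T := {p : B * W | fconnect fphi d (p, true)}.

Let half_turn (p : B * W) : B * W := (sW p.2 p.1, p.2).
Let turn (p : B * W) : B * W := (sW p.2 p.1, sB (sW p.2 p.1) p.2).

Let turn_face p : fconnect fphi d (p, true) = fconnect fphi d (turn p, true).
Proof.
case: p => b w; rewrite (same_fconnect1_r fphi_inj d (b, w, true)) /=.
by rewrite (same_fconnect1_r fphi_inj d (sW w b, w, false)).
Qed.

Let turn_inj : injective turn.
Proof.
move=> [b w] [b' w'] e; suff [-> ->] : (b, w, true) = (b', w', true) by [].
apply: fphi_inj; apply: fphi_inj; rewrite /=.
by case: e => e1 e2; rewrite /= in e1 e2; rewrite e2 e1.
Qed.

Let g_subproof (t : T) : fconnect fphi d (turn (val t), true).
Proof. by rewrite -turn_face; apply: (valP t). Qed.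

Let g_fun (t : T) : T := Sub (turn (val t)) (g_subproof t).

Let g_inj : injective g_fun.
Proof. by move=> t t' /(congr1 val) /turn_inj/val_inj. Qed.

Let g := perm g_inj.

Let turnE p : (turn p, true) = fphi (fphi (p, true)).
Proof. by case: p. Qed.

Let iter_g k (t : T) : (val ((g ^+ k)%g t), true) = iter k.*2 fphi (val t, true).
Proof.
elim: k t => [|k IHk] t; first by rewrite expg0 perm1.
rewrite doubleS expgSr permM permE !iterS -IHk.
exact: turnE.
Qed.

Let iter_dir k (p : B * W) : (iter k fphi (p, true)).2 = ~~ odd k.
Proof.
by elim: k => // k IHk; rewrite oddS -IHk iterS; case: (iter _ _ _) => [[b w] []].
Qed.

(** Directions alternate along the face, so one edge of [T] is reached from another in an even
    number of steps of [fphi], that is, by a power of [g]. Hence [g] is a single cycle on [T]. *)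
Let g_odd : (0 < #|{: T}|)%N -> g = ~~ odd #|{: T}| :> bool.
Proof.
move=> /card_gt0P[t0 _]; rewrite /odd_perm (_ : porbits g = [set setT]) ?cards1 ?addbT //.
have all_orbit (t t' : T) : t' \in porbit g t.
  apply/porbitP; have : fconnect fphi (val t, true) (val t', true).
    by apply: connect_trans (valP t'); rewrite (fconnect_sym fphi_inj); apply: (valP t).
  move/iter_findex; set k := findex _ _ _ => ek.
  have ev : odd k = false by apply/negbTE; rewrite -(iter_dir k (val t)) ek.
  exists k./2; apply: val_inj.
  have := iter_g k./2 t; rewrite (_ : k./2.*2 = k)%N ?ek; last by rewrite -[RHS]odd_double_half ev.
  by move=> /(congr1 fst)/esym.
apply/setP=> A; rewrite inE; apply/imsetP/eqP=> [[t _ ->]|->]; [|exists t0 => //; apply/esym].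
  by apply/setP=> t'; rewrite inE; apply: all_orbit.
by apply/setP=> t'; rewrite inE; apply: all_orbit.
Qed.

Let x : {ffun B * W -> 'F_2} := [ffun p => on_face d p.1 p.2 true].
Let y : {ffun B * W -> 'F_2} := [ffun p => on_face d p.1 p.2 false].

(** For a chain [z] whose edges are listed by [h], the form is an inversion number of the index set,
    to which the rules on inversions apply. *)
Let form_sub (h : B * W -> B * W) (z : {ffun B * W -> 'F_2}) :
  (forall G, \sum_p z p * G p = \sum_(t : T) G (h (val t))) ->
  form z = inversions (fun t t' : T => elB (h (val t)) (h (val t')))
               (fun t t' : T => elW (h (val t)) (h (val t'))).
Proof.
move=> zE; rewrite /inv_form; under eq_bigr => p _.
  under eq_bigr do rewrite -mulrA; rewrite -mulr_sumr zE; over.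
by rewrite zE.
Qed.

(** An edge of [x] and its half turn in [y] share their white vertex, and the black vertex of the
    half turn is that of the image under [g]. Within a matching only endpoints matter for the
    orders, so [y] has the white order of [x] and its black order shifted by [g]. The two forms add
    up to the parity of the cycle [g]. *)
Lemma form_face_halves : (0 < #|{: T}|)%N -> form x + form y = #|{: T}|%:R + 1.
Proof.
move=> T0; rewrite (@form_sub id x); last first.
  by move=> G; rewrite -sum_indicator_sig; apply: eq_bigr => -[b w] _; rewrite ffunE.
rewrite (@form_sub half_turn y); last first.
  move=> G; under eq_bigr do rewrite ffunE; rewrite sum_on_face_false.
  by rewrite -(sum_indicator_sig _ (G \o half_turn)); apply: eq_bigr => -[b w] _.
have neqB (t t' : T) : t != t' -> (val t).1 != (val t').1.
  case: t t' => [[b w] h] [[b' w'] h'] /=; apply: contraNneq => e; subst b'.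
  by apply/eqP/val_inj => /=; rewrite (face_uniq_B h h').
have neqW (t t' : T) : t != t' -> (val t).2 != (val t').2.
  case: t t' => [[b w] h] [[b' w'] h'] /=; apply: contraNneq => e; subst w'.
  by apply/eqP/val_inj => /=; rewrite (face_uniq_W h h').
have tB : tournament (fun t t' : T => elB (val t) (val t')).
  exact/tournament_pre/tournament_elB/val_inj.
have tW : tournament (fun t t' : T => elW (val t) (val t')).
  exact/tournament_pre/tournament_elW/val_inj.
have -> : inversions (fun t t' : T => elB (half_turn (val t)) (half_turn (val t')))
              (fun t t' : T => elW (half_turn (val t)) (half_turn (val t')))
    = inversions (rel_perm (fun t t' : T => elB (val t) (val t')) g)
          (fun t t' : T => elW (val t) (val t')).
  apply: eq_inv => t t'.
    rewrite /rel_perm !permE /elB /half_turn /=.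
    have [->|neq] := eqVneq t t'; first by rewrite /lexlt !ltnn !andbF.
    have /negPf e : (val (g t)).1 != (val (g t')).1 by rewrite neqB ?(inj_eq perm_inj).
    by rewrite /lexlt; rewrite !permE /= in e; rewrite e.
  rewrite /elW /half_turn /=.
  have [->|neq] := eqVneq t t'; first by rewrite /lexlt !ltnn !andbF.
  by rewrite /lexlt (negPf (neqW _ _ neq)).
rewrite (inv_sym (rel_perm _ _)) -inv_trans //; last exact/tournament_pre/tB/perm_inj.
by rewrite inv_perm // g_odd // natF2_neg natF2_odd addrC.
Qed.

(** The boundary is the sum of the matchings [x] and [y]. As the polar form is alternating, its
    value at [x] and [y] is its value at [x] and the whole boundary, given by [polar_face]. Each
    cilium in the face then counts once, since [x] has degree one at the vertices of the face. *)
Lemma form_face : form (face_chain d) =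
  (fingraph.order fphi d)./2%:R + 1
  + (\sum_b on_face d b (cB b) false + \sum_w on_face d (cW w) w true).
Proof.
have cT : #|{: T}| = #|[pred p | fconnect fphi d (p, true)]| by rewrite card_sig.
have T0 : (0 < #|{: T}|)%N.
  by rewrite cT -double_gt0 -card_face (fingraph.order_gt0 fphi).
have -> : face_chain d = x + y by apply/ffunP=> -[b w]; rewrite !ffunE.
rewrite (inv_formD tournament_elB tournament_elW) form_face_halves // cT card_face doubleK.
congr (_ + _); have -> : polar x y = polar x (x + y).
  by rewrite inv_polarD (inv_polar_self tournament_elB tournament_elW) add0r.
have -> : x + y = face_chain d by apply/ffunP=> -[b w]; rewrite !ffunE.
rewrite polar_face //; last by move=> b w nadj; rewrite ffunE on_face_adj.
congr (_ + _).
  apply: eq_bigr => b _; rewrite -on_face_sB /on_face; case: (boolP (fconnect _ _ _)) => h; last by rewrite mul0r.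
  rewrite mul1r (bigD1 (sB b (cB b))) //= ffunE /on_face /= h big1 ?addr0 // => w neq.
  rewrite ffunE /on_face /=; case: (boolP (fconnect _ _ _)) => // h'.
  by rewrite (face_uniq_B h' h) eqxx in neq.
apply: eq_bigr => w _; rewrite /on_face; case: (boolP (fconnect _ _ _)) => h; last by rewrite mul0r.
rewrite mul1r (bigD1 (cW w)) //= ffunE /on_face /= h big1 ?addr0 // => b neq.
rewrite ffunE /on_face /=; case: (boolP (fconnect _ _ _)) => // h'.
by rewrite (face_uniq_W h' h) eqxx in neq.
Qed.
End SimpleFace.
End Plane.

(** * The mod 2 cycle space *)

Lemma sum_sig_supp (T : finType) (P : pred T) (G : T -> 'F_2) :
  (forall p, ~~ P p -> G p = 0) -> \sum_(t : {p | P p}) G (val t) = \sum_p G p.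
Proof.
move=> G0; rewrite -sum_indicator_sig; apply: eq_bigr => p _.
by case: (boolP (P p)) => [|/G0->]; rewrite ?mul1r ?mulr0.
Qed.

Lemma sum_sig_delta (T : finType) (P : pred T) (x : T) (Px : P x) (h : {p | P p} -> 'F_2) :
  \sum_t (val t == x)%:R * h t = h (Sub x Px).
Proof.
rewrite (bigD1 (Sub x Px)) //= eqxx mul1r big1 ?addr0 // => t.
by rewrite -(inj_eq val_inj) => /negPf->; rewrite mul0r.
Qed.

Section Kasteleyn.
Variables (R : realFieldType) (B W : finType) (adj : B -> W -> bool).
Variables (sB : B -> {perm W}) (sW : W -> {perm B}) (outer : pred (dart B W)).
Variables (nB : B -> nat) (nW : W -> nat) (cB : B -> W) (cW : W -> B).
Variable eps : B -> W -> R.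
Hypothesis plane : plane_bipartite_graph adj sB sW outer.
Hypothesis cil : cilia_ok adj cB cW.
Hypothesis kast : kasteleyn adj sB sW outer nB nW cB cW eps.

Local Notation fphi := (fphi sB sW).
Local Notation is_dart := (is_dart adj).
Local Notation adjV := (@adjV B W adj).
Local Notation form := (inv_form (elB adj sB cB) (elW adj sW cW)).
Local Notation polar := (inv_polar (elB adj sB cB) (elW adj sW cW)).
Local Notation face_chain := (face_chain sB sW).

Let rot : rotation_system adj sB sW. Proof. by case: plane. Qed.
Let fI : injective fphi := @fphi_inj B W sB sW.
Let fsym := fconnect_sym fI.

Let plane_simple d : bounded_dart adj outer d -> {in fconnect fphi d &, injective (@head B W)}.
Proof. by case: plane => _ _ _ h /h[]. Qed.

Definition eps_bit (p : B * W) : 'F_2 := (eps p.1 p.2 == -1)%:R.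

Lemma eps_bitE b w : adj b w -> eps b w = sg R (eps_bit (b, w)).
Proof.
move=> a; rewrite /eps_bit /=; case: eqP => [->//|ne].
by case: (kast.1 _ _ a).
Qed.

(** The inversion form together with the signs [eps] of the edges: up to a constant, the exponent of
    the sign with which a multiweb enters the determinant. *)
Definition kform (m : {ffun B * W -> 'F_2}) : 'F_2 := form m + \sum_p eps_bit p * m p.

Definition mod2_web (m : {ffun B * W -> 'F_2}) : Prop :=
  [/\ forall b w, ~~ adj b w -> m (b, w) = 0,
      forall b, \sum_w m (b, w) = (nB b)%:R & forall w, \sum_b m (b, w) = (nW w)%:R].

Definition mod2_cycle (z : {ffun B * W -> 'F_2}) : Prop :=
  [/\ forall b w, ~~ adj b w -> z (b, w) = 0,
      forall b, \sum_w z (b, w) = 0 & forall w, \sum_b z (b, w) = 0].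

Lemma mod2_webD m z : mod2_web m -> mod2_cycle z -> mod2_web (m + z).
Proof.
move=> [m0 mB mW] [z0 zB zW]; split=> [b w na|b|w]; first by rewrite ffunE m0 // z0 // addr0.
  by under eq_bigr do rewrite ffunE; rewrite big_split /= mB zB addr0.
by under eq_bigr do rewrite ffunE; rewrite big_split /= mW zW addr0.
Qed.

(** Asking for invariance at every mod 2 web makes these cycles closed under addition, so generators
    of the cycle space suffice. *)
Definition inert z := mod2_cycle z /\ forall m, mod2_web m -> kform (m + z) = kform m.

Lemma inert0 : inert 0.
Proof.
split; first by split=> *; rewrite ?ffunE ?big1 // => *; rewrite ffunE.
by move=> m _; rewrite addr0.
Qed.

Lemma inertD z z' : inert z -> inert z' -> inert (z + z').
Proof.
move=> [cz iz] [cz' iz']; split.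
  case: cz cz' => [z0 zB zW] [z'0 z'B z'W]; split=> [b w na|b|w].
  - by rewrite ffunE z0 // z'0 // addr0.
  - by under eq_bigr do rewrite ffunE; rewrite big_split /= zB z'B addr0.
  - by under eq_bigr do rewrite ffunE; rewrite big_split /= zW z'W addr0.
by move=> m gm; rewrite addrA iz' ?iz //; apply: mod2_webD.
Qed.

Lemma face_cycle d : is_dart d -> mod2_cycle (face_chain d).
Proof.
move=> dd; split=> [b w na|b|w].
- by rewrite ffunE /= !(on_face_adj rot) // addr0.
- under eq_bigr do rewrite ffunE /=; rewrite big_split /=.
  rewrite (reindex_inj (@perm_inj _ (sB b))) /=.
  by under eq_bigr do rewrite on_face_sB; rewrite addF2.
- under eq_bigr do rewrite ffunE /=; rewrite big_split /= addrC.
  rewrite (reindex_inj (@perm_inj _ (sW w))) /=.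
  by under eq_bigr do rewrite on_face_sW; rewrite addF2.
Qed.

Lemma sum_face d (G : B * W -> 'F_2) :
  \sum_p face_chain d p * G p = \sum_(d' | fconnect fphi d d') G d'.1.
Proof.
rewrite [RHS]big_mkcond [RHS]big_pair; apply: eq_bigr => -[b w] _; rewrite big_bool ffunE mulrDl /on_face /=.
by congr (_ + _); case: ifP; rewrite ?mul1r ?mul0r.
Qed.

(** Let l be half the length of the face. The form at the boundary is l + 1 plus the number of cilia
    in the face, the polar term is the sum of n_v over these cilia, and the signs [eps] contribute l
    + 1 plus [k_face]. Modulo 2 the three cancel. *)
Lemma inert_face d : bounded_dart adj outer d -> inert (face_chain d).
Proof.
move=> bd; have /andP[dd _] := bd; have cz := face_cycle dd; split=> // m [m0 mB mW].
have polE : polar m (face_chain d) = \sum_b on_face sB sW d b (cB b) false * (nB b)%:R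
    + \sum_w on_face sB sW d (cW w) w true * (nW w)%:R.
  rewrite polar_face //; congr (_ + _); apply: eq_bigr => v _; by rewrite ?mB ?mW.
have formE := @form_face _ _ _ _ _ cB cW rot cil d dd (plane_simple bd).
have epsE : \sum_p eps_bit p * face_chain d p
    = ((fingraph.order fphi d)./2 + 1 + k_face sB sW nB nW cB cW d)%:R.
  apply: (@sg_inj R); rewrite sg_nat -(kast.2 _ bd).
  have -> : \sum_p eps_bit p * face_chain d p = \sum_p face_chain d p * eps_bit p.
    by apply: eq_bigr => p _; rewrite mulrC.
  rewrite sum_face sg_sum; apply: eq_bigr => -[[b w] dir] /=.
  move/(is_dart_fconnect rot); rewrite dd => /esym ad.
  by rewrite eps_bitE.
have cardE (T : finType) (P : pred T) : #|[pred t | P t]|%:R = \sum_t (P t)%:R :> 'F_2.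
  by rewrite -sum1_card natr_sum big_mkcond; apply: eq_bigr => t _; rewrite inE; case: (P t).
(* A cilium at v counts in [k_face] when n_v is even, which is n_v + 1 modulo 2. *)
have kE : (k_face sB sW nB nW cB cW d)%:R = polar m (face_chain d)
    + (\sum_b on_face sB sW d b (cB b) false + \sum_w on_face sB sW d (cW w) w true).
  rewrite polE addrACA -!big_split /k_face natrD !cardE.
  by congr (_ + _); apply: eq_bigr => v _;
    rewrite natF2_and natF2_neg natF2_odd /on_face /=; ring.
rewrite /kform (inv_formD (tournament_elB _ _ _) (tournament_elW _ _ _)).
under [X in _ + X]eq_bigr do rewrite ffunE mulrDr; rewrite big_split /= epsE natrD kE formE natrD.
set ci := \sum_b _ + \sum_w on_face sB sW d (cW w) w true.
set l := (fingraph.order _ _)./2%:R; move: (polar _ _) => pol.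
rewrite -[RHS]addr0 -[X in _ = _ + X](addF2 (l + 1 + ci + pol)); ring.
Qed.

Let adjV_sym : symmetric adjV.
Proof. by case=> [b|w] [b'|w']. Qed.

Let csym : connect_sym adjV.
Proof. exact: sym_connect_sym. Qed.

Lemma head_fphi d : is_dart d -> adjV (head d) (head (fphi d)).
Proof. by case: d => [[b w] []]; rewrite /Defs.is_dart /= ?(adj_sB rot) ?(adj_sW rot). Qed.

Lemma connect_head d d' : is_dart d -> fconnect fphi d d' -> connect adjV (head d) (head d').
Proof.
move=> dd /iter_findex <-; elim: (findex _ _ _) => [|k IHk] /=; first exact: connect0.
apply: connect_trans IHk (connect1 _); apply: head_fphi.
by rewrite -(is_dart_fconnect rot (fconnect_iter fphi k d)).
Qed.

(** * Cycles within one connected component *)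

Section Component.
Variable v : vtx B W.
Hypothesis nv : nonisolated adj v.

Let V := {u | connect adjV v u}.
Let EP := [pred p : B * W | adj p.1 p.2 && connect adjV v (inl p.1)].
(** Faces are represented by the root darts of their orbits, as in the count [fcard] of Euler's
    formula. *)
Let FP := [pred d : dart B W | froots fphi d && (is_dart d && connect adjV v (head d))].
Let E := {p | EP p}.
Let F := {d | FP d}.

Let connect_edge b w : adj b w -> connect adjV v (inl b) = connect adjV v (inr w).
Proof. by move=> a; apply: (same_connect1r csym). Qed.

Let EP_head b w dir : adj b w -> EP (b, w) = connect adjV v (head (b, w, dir)).
Proof. by move=> a; rewrite /EP /= a; case: dir => //=; apply: connect_edge. Qed.

Let D (e : E) (u : V) : 'F_2 := (val u == inl (val e).1)%:R + (val u == inr (val e).2)%:R.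
Let M (f : F) (e : E) : 'F_2 := face_chain (val f) (val e).

Let on_face_EP (f : F) b w dir : ~~ EP (b, w) -> on_face sB sW (val f) b w dir = 0.
Proof.
have /and3P[_ dd cd] := valP f; rewrite /on_face; case: (boolP (fconnect _ _ _)) => // h.
have a : adj b w by move: dd; rewrite (is_dart_fconnect rot h).
by rewrite (EP_head dir a) (connect_trans cd (connect_head dd h)).
Qed.

Let face_EP (f : F) p : ~~ EP p -> face_chain (val f) p = 0.
Proof. by case: p => b w h; rewrite ffunE !on_face_EP ?addr0. Qed.

Let delta_sum (G : B * W -> 'F_2) (u : vtx B W) :
  \sum_p G p * ((u == inl p.1)%:R + (u == inr p.2)%:R)
  = match u with inl b => \sum_w G (b, w) | inr w => \sum_b G (b, w) end.
Proof.
rewrite big_pair; case: u => [b0|w0].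
  transitivity (\sum_b \sum_w G (b, w) * (b0 == b)%:R).
    by apply: eq_bigr => b _; apply: eq_bigr => w _; congr (_ * _); apply: addr0.
  rewrite (bigD1 b0) //= [X in _ + X]big1 ?addr0 => [|b neq].
    by apply: eq_bigr => w _; rewrite eqxx mulr1.
  by rewrite big1 // => w _; rewrite eq_sym (negPf neq) mulr0.
rewrite exchange_big; transitivity (\sum_w \sum_b G (b, w) * (w0 == w)%:R).
  by apply: eq_bigr => w _; apply: eq_bigr => b _; congr (_ * _); apply: add0r.
rewrite (bigD1 w0) //= [X in _ + X]big1 ?addr0 => [|w neq].
  by apply: eq_bigr => b _; rewrite eqxx mulr1.
by rewrite big1 // => b _; rewrite eq_sym (negPf neq) mulr0.
Qed.

Let MD0 f u : \sum_e M f e * D e u = 0.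
Proof.
rewrite (sum_sig_supp (P := EP) (G := fun p => face_chain (val f) p *
  ((val u == inl p.1)%:R + (val u == inr p.2)%:R))) => [|p /face_EP->]; last by rewrite mul0r.
rewrite delta_sum; case: f => d /= /and3P[_ /face_cycle[_ zB zW] _].
by case: (val u) => [b|w]; rewrite ?zB ?zW.
Qed.

(** The condition says that [h] agrees at the two ends of every edge, and the component is
    connected. *)
Let D_const (h : V -> 'F_2) : (forall e, \sum_u D e u * h u = 0) -> forall u u', h u = h u'.
Proof.
move=> hD; pose u0 : V := Sub v (connect0 _ _).
have edge b w (cb : connect adjV v (inl b)) (cw : connect adjV v (inr w)) :
    adj b w -> h (Sub _ cb) = h (Sub _ cw).
  move=> a; have epw : EP (b, w) by rewrite /= a cb.
  have := hD (Sub (b, w) epw); rewrite /D /=.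
  under eq_bigr do rewrite mulrDl; rewrite big_split /=.
  by rewrite (sum_sig_delta cb) (sum_sig_delta cw) => /eqP; rewrite addF2_eq0 => /eqP.
(* [h] lives on the subtype [V], while closedness concerns all vertices; hence the quantification
   over the elements of [V] above [x]. *)
pose a := [pred x | [forall u : V, (val u == x) ==> (h u == h u0)]].
have cla : closed adjV a.
  apply: (intro_closed csym) => x y xy /forallP ax; apply/forallP => -[y' cy]; apply/implyP => /= /eqP e.
  subst y'; have cx : connect adjV v x by rewrite (same_connect1r csym xy).
  have /eqP <- : h (Sub x cx) == h u0 by have /implyP := ax (Sub x cx); apply; rewrite /= eqxx.
  apply/eqP; case: x y xy cx cy {ax} => [b|w] [b'|w'] //= xy cx cy; last exact: edge.
  by apply/esym; apply: edge.
have va : v \in a.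
  by apply/forallP => u; apply/implyP => /eqP e; apply/eqP; congr h; apply: val_inj.
have all_eq u : h u = h u0.
  have : val u \in a by rewrite -(closed_connect cla (valP u)).
  by move/forallP/(_ u)/implyP => /(_ (eqxx _)) /eqP.
by move=> u u'; rewrite !all_eq.
Qed.

(* [dval h] is the function on darts which is [h f] along the face [f]. *)
Let dval (h : F -> 'F_2) (d : dart B W) : 'F_2 := \sum_f h f * (fconnect fphi (val f) d)%:R.

Let dval_fphi h d : dval h (fphi d) = dval h d.
Proof. by apply: eq_bigr => f _; rewrite (same_fconnect1_r fI _ d). Qed.

Let froot_FP d : is_dart d -> connect adjV v (head d) -> FP (froot fphi d).
Proof.
move=> dd cd; have c := connect_root (frel fphi) d.
rewrite /= roots_root //= -(is_dart_fconnect rot c) dd.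
exact: connect_trans cd (connect_head dd c).
Qed.

Let dvalE h d (dd : is_dart d) (cd : connect adjV v (head d)) :
  dval h d = h (Sub (froot fphi d) (froot_FP dd cd)).
Proof.
rewrite -(sum_sig_delta (froot_FP dd cd)); apply: eq_bigr => -[f fF] _ /=.
rewrite mulrC; congr (_ * _); congr (_%:R); congr nat_of_bool.
have /andP[/eqP rf _] := fF.
by rewrite -[X in X == _]rf (root_connect fsym).
Qed.

(** Dually, [h] agrees on the two sides of every edge. Crossing the edges around a vertex one after
    another shows that all its corners carry one value, and moving along edges spreads this value
    over the component. *)
Let M_const (h : F -> 'F_2) : (forall e, \sum_f h f * M f e = 0) -> forall f f', h f = h f'.
Proof.
move=> hM.
have edge b w : EP (b, w) -> dval h (b, w, true) = dval h (b, w, false).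
  move=> ep; have := hM (Sub (b, w) ep); rewrite /M /=.
  under eq_bigr do rewrite ffunE mulrDr; rewrite big_split /= => /eqP.
  by rewrite addF2_eq0 => /eqP.
have hb b w w' : connect adjV v (inl b) -> adj b w -> adj b w' ->
    dval h (b, w, false) = dval h (b, w', false).
  move=> cb a a'; have cw := fconnect_sB rot a a'.
  apply: (@fconnect_invariant _ (sB b) _ (fun w => dval h (b, w, false))) cw => u.
  rewrite /invariant /=; case: (boolP (adj b u)) => au; last by case: rot => fB _ _ _; rewrite fB // eqxx.
  by rewrite -edge /= ?(adj_sB rot) ?au ?cb // -[(b, sB b u, true)]/(fphi (b, u, false)) dval_fphi eqxx.
have hw w b b' : connect adjV v (inr w) -> adj b w -> adj b' w ->
    dval h (b, w, true) = dval h (b', w, true).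
  move=> cw a a'; have cb : fconnect (sW w) b b' by case: rot => _ _ _; apply.
  apply: (@fconnect_invariant _ (sW w) _ (fun b => dval h (b, w, true))) cb => u.
  rewrite /invariant /=; case: (boolP (adj u w)) => au; last by case: rot => _ _ fW _; rewrite fW // eqxx.
  rewrite edge ?(EP_head true) ?(adj_sW rot) //.
  by rewrite -[(sW w u, w, false)]/(fphi (u, w, true)) dval_fphi eqxx.
have same d d' : is_dart d -> is_dart d' -> connect adjV v (head d) -> head d = head d' ->
    dval h d = dval h d'.
  case: d d' => [[b w] []] [[b' w'] []] //= a a' c [] e; [subst w'; exact: hw | subst b'; exact: hb].
suff all_eq d d' : is_dart d -> is_dart d' -> connect adjV v (head d) ->
    connect adjV v (head d') -> dval h d = dval h d'.
  have valE (f : F) : h f = dval h (val f).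
    have /and3P[/eqP rf df cf] := valP f; rewrite (dvalE h df cf).
    by congr h; apply: val_inj; rewrite /= rf.
  move=> f f'; rewrite !valE; have /and3P[_ ? ?] := valP f; have /and3P[_ ? ?] := valP f'.
  exact: all_eq.
move=> dd dd' cd cd'.
(* The vertices all of whose incoming darts carry the value of [d]. *)
pose a := [pred x | [forall d1, (is_dart d1 && (head d1 == x)) && connect adjV v x
  ==> (dval h d1 == dval h d)]].
have cla : closed adjV a.
  apply: (intro_closed csym) => x y xy /forallP ax; apply/forallP => d1.
  apply/implyP => /andP[/andP[dd1 /eqP hd1] cy].
  have cx : connect adjV v x by rewrite (same_connect1r csym xy).
  case: x y xy cx cy hd1 ax => [b|w] [b'|w'] //= xy cx cy hd1 ax.
    have /implyP := ax (b, w', false); rewrite /= {1}/Defs.is_dart /= xy cx !eqxx => /(_ isT)/eqP <-.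
    by rewrite -edge /= ?xy ?cx //; apply/eqP/same; rewrite ?hd1.
  have /implyP := ax (b', w, true); rewrite /= {1}/Defs.is_dart /= xy cx !eqxx => /(_ isT)/eqP <-.
  by rewrite edge /= ?xy ?cy //; apply/eqP/same; rewrite ?hd1.
have da : head d \in a.
  apply/forallP => d1; apply/implyP => /andP[/andP[dd1 /eqP hd1] _].
  by apply/eqP/same => //; rewrite hd1.
have : head d' \in a.
  have cdd' : connect adjV (head d) (head d') by rewrite -(same_connect csym cd).
  by rewrite -(closed_connect cla cdd').
by move/forallP/(_ d'); rewrite dd' cd' eqxx => /eqP.
Qed.

Let euler : (#|{: V}| + #|{: F}| = #|{: E}| + 2)%N.
Proof.
case: plane => _ /(_ v nv) eu _ _; by rewrite !card_sig -[RHS]eu.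
Qed.

Lemma inert_component (z : {ffun B * W -> 'F_2}) : mod2_cycle z ->
  inert [ffun p => if connect adjV v (inl p.1) then z p else 0].
Proof.
move=> [z0 zB zW]; set zv := finfun _.
have zvE p : ~~ EP p -> zv p = 0.
  case: p => b w; rewrite ffunE /= negb_and; case: ifP => //= _; rewrite orbF; exact: z0.
have zD (u : V) : \sum_e zv (val e) * D e u = 0.
  rewrite (sum_sig_supp (P := EP) (G := fun p => zv p *
    ((val u == inl p.1)%:R + (val u == inr p.2)%:R))) => [|p /zvE->]; last by rewrite mul0r.
  rewrite delta_sum; case: u => -[b|w] /= cu.
    by under eq_bigr do rewrite ffunE /= cu; apply: zB.
  rewrite -[RHS](zW w); apply: eq_bigr => b _; rewrite ffunE /=.
  have [a|na] := boolP (adj b w); last by rewrite z0 // if_same.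
  by rewrite (connect_edge a) cu.
have [y zy] := exact_of_euler MD0 D_const M_const euler (z := fun e : E => zv (val e)) zD.
have [d0 od0 cd0] : exists2 d, outer d & connect adjV v (head d).
  by case: plane => _ _ [_ _ _ h] _; apply: h.
have dd0 : is_dart d0 by case: plane => _ _ [h _ _ _] _; apply: h.
(* The outer face of the component. Every edge has two sides, so all face boundaries together sum to
   0, and the constant [y f0] may be added to all coefficients. This removes the outer face from the
   expression of [zv]. *)
pose f0 : F := Sub (froot fphi d0) (froot_FP dd0 cd0).
have sumM e : \sum_f M f e = 0.
  transitivity (\sum_f (fun=> 1) f * M f e); first by apply: eq_bigr => f _; rewrite mul1r.
  case: e => [[b w] ep]; under eq_bigr do rewrite /M ffunE mulrDr; rewrite big_split /=.
  have /andP[/= a cb] := ep.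
  rewrite -![\sum_f _]/(dval (fun=> 1) _) (@dvalE _ (b, w, true) a) ?(@dvalE _ (b, w, false) a) ?addF2 //=.
  by rewrite -(connect_edge a).
have -> : zv = \sum_(f | y f != y f0) face_chain (val f).
  apply/ffunP=> p; rewrite sum_ffunE; have [ep|nep] := boolP (EP p); last first.
    by rewrite zvE // big1 // => f _; rewrite face_EP.
  have /= -> := zy (Sub p ep); rewrite [RHS]big_mkcond /=.
  have e0 : \sum_f y f0 * M f (Sub p ep) = 0 by rewrite -mulr_sumr sumM mulr0.
  transitivity (\sum_f (y f * M f (Sub p ep) + y f0 * M f (Sub p ep))).
    by rewrite big_split /= e0 addr0.
  apply: eq_bigr => f _ /=; rewrite -mulrDl /M /=; case: eqVneq => [->|neq].
    by rewrite addF2 mul0r.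
  have -> : y f + y f0 = 1; last by rewrite mul1r.
  by move: neq; case: (F2P (y f)) => ->; case: (F2P (y f0)) => ->; rewrite ?eqxx ?addr0 ?add0r.
apply: (big_ind inert) => [||f neq]; [exact: inert0 | exact: inertD |].
apply: inert_face; have /and3P[rf df cf] := valP f; rewrite /bounded_dart df /=.
(* If [val f] were outer, it would lie in the orbit of [d0] and have the same root, making [f] equal
   to [f0]. *)
apply: contra neq => of_; apply/eqP; congr y; apply: val_inj => /=.
have /(fingraph.rootP fsym) <- : fconnect fphi (val f) d0; last by rewrite [RHS](eqP rf).
by case: plane => _ _ [_ _ h _] _; apply: h => //; rewrite -(same_connect csym cf).
Qed.
End Component.

(** [z] is cut into its restrictions to the connected components, one for each root; the restriction
    at an isolated vertex is 0. *)
Lemma inert_cycle z : mod2_cycle z -> inert z.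
Proof.
move=> cz; have [z0 _ _] := cz.
pose zr v : {ffun B * W -> 'F_2} := [ffun p => if connect adjV v (inl p.1) then z p else 0].
have -> : z = \sum_(v | roots adjV v) zr v.
  apply/ffunP=> p; rewrite sum_ffunE (bigD1 (fingraph.root adjV (inl p.1))) /=; last exact: roots_root.
  rewrite ffunE csym connect_root big1 ?addr0 // => u /andP[/eqP ru neq]; rewrite ffunE.
  case: ifP => // c; case/eqP: neq; rewrite -ru; exact/(fingraph.rootP csym).
apply: (big_ind inert) => [||v _]; [exact: inert0 | exact: inertD |].
have [nv|iv] := boolP (nonisolated adj v); first exact: inert_component.
suff -> : zr v = 0 by apply: inert0.
apply/ffunP=> -[b w]; rewrite !ffunE /=; case: ifP => // /connectP[[|u q] /=].
  move=> _ e; apply: z0; apply: contraNN iv => a; apply/existsP; exists (inr w).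
  by rewrite -e.
by case/andP=> vu _ _; case/negP: iv; apply/existsP; exists u.
Qed.

(** Modulo 2 the two webs differ by the cycle m + m', which is inert. *)
Lemma kform_const m m' : mod2_web m -> mod2_web m' -> kform m = kform m'.
Proof.
move=> wm [m'0 m'B m'W]; have [m0 mB mW] := wm.
have /inert_cycle[_ /(_ m wm) <-] : mod2_cycle (m + m').
  split=> [b w na|b|w]; first by rewrite ffunE m0 // m'0 // addr0.
    by under eq_bigr do rewrite ffunE; rewrite big_split /= mB m'B addF2.
  by under eq_bigr do rewrite ffunE; rewrite big_split /= mW m'W addF2.
by congr kform; apply/ffunP=> p; rewrite !ffunE addF2K.
Qed.
End Kasteleyn.

(** * Colorings and the determinant *)

Lemma prodr_natb (R : comNzRingType) (I : finType) (b : pred I) :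
  \prod_i (b i)%:R = [forall i, b i]%:R :> R.
Proof.
case: (boolP [forall i, b i]) => [/forallP h|]; first by apply: big1 => i _; rewrite h.
by rewrite negb_forall => /existsP[i /negPf h]; rewrite (bigD1 i) //= h mul0r.
Qed.

Lemma sqdet_cast (R : realFieldType) m n (e : m = n) (A : 'M[R]_(m, n)) :
  sqdet A = \det (mxsub id (cast_ord e) A).
Proof.
by subst n; rewrite /sqdet conform_mx_id; congr (\det _); apply/matrixP=> i j; rewrite mxE cast_ord_id.
Qed.

Lemma det_size0 (R : comNzRingType) n (A : 'M[R]_n) : n = 0%N -> \det A = 1.
Proof. by move=> e; move: A; rewrite e => A; apply: det_mx00. Qed.

(** * Grouping the permutations by coloring *)

Section Expansion.
Variables (R : realFieldType) (X Y B W : finType) (tX : X -> W) (tY : Y -> B).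
Variable F : X -> Y -> R.
Hypothesis cardXY : #|X| = #|Y|.

Definition compatible (colB : {ffun Y -> W}) (colW : {ffun X -> B}) x y :=
  (colB y == tX x) && (colW x == tY y).

Definition colored_mx colB colW : 'M[R]_(#|X|, #|Y|) :=
  \matrix_(i, j) (F (enum_val i) (enum_val j)
                  * (compatible colB colW (enum_val i) (enum_val j))%:R).

Let y j := enum_val (cast_ord cardXY j).

Let rank_y z : y (cast_ord (esym cardXY) (enum_rank z)) = z.
Proof. by rewrite /y cast_ordKV enum_rankK. Qed.

Let det_colored colB colW : sqdet (colored_mx colB colW) =
  \sum_(s : 'S_#|X|) (-1) ^+ s * ((\prod_i F (enum_val i) (y (s i)))
    * [forall i, compatible colB colW (enum_val i) (y (s i))]%:R).
Proof.
rewrite (sqdet_cast cardXY); apply: eq_bigr => s _; congr (_ * _).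
by under eq_bigr do rewrite !mxE; rewrite big_split /= prodr_natb.
Qed.

(* Each permutation is compatible with exactly one pair of colorings. *)
Lemma sqdet_expand :
  sqdet (\matrix_(i < #|X|, j < #|Y|) F (enum_val i) (enum_val j))
  = \sum_(colB : {ffun Y -> W}) \sum_(colW : {ffun X -> B}) sqdet (colored_mx colB colW).
Proof.
under [RHS]eq_bigr do under eq_bigr do rewrite det_colored.
under [RHS]eq_bigr do rewrite exchange_big /=.
rewrite [RHS]exchange_big (sqdet_cast cardXY); apply: eq_bigr => s _ /=.
rewrite [X in _ * X = _](eq_bigr (fun i => F (enum_val i) (y (s i)))); last first.
  by move=> i _; rewrite !mxE.
pose cB0 : {ffun Y -> W} :=
  [ffun z => tX (enum_val ((s^-1)%g (cast_ord (esym cardXY) (enum_rank z))))].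
pose cW0 : {ffun X -> B} := [ffun x => tY (y (s (enum_rank x)))].
have uniqC colB colW : [forall i, compatible colB colW (enum_val i) (y (s i))]
    = (colB == cB0) && (colW == cW0).
  apply/forallP/andP => [h|[/eqP-> /eqP->] i]; last first.
    by rewrite /compatible !ffunE /y !enum_valK cast_ordK permK !eqxx.
  split; apply/eqP/ffunP=> z; rewrite ffunE.
    by have /andP[/eqP <- _] := h ((s^-1)%g (cast_ord (esym cardXY) (enum_rank z)));
      rewrite permKV rank_y.
  by have /andP[_ /eqP <-] := h (enum_rank z); rewrite enum_rankK.
rewrite (bigD1 cB0) //= (bigD1 cW0) //= uniqC !eqxx mulr1 -addrA -[LHS]addr0.
congr (_ + _); rewrite big1 ?add0r; last first.
  by move=> colW /negPf h; rewrite uniqC h andbF !mulr0.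
rewrite big1 // => colB /negPf h; rewrite big1 // => colW _.
by rewrite uniqC h !mulr0.
Qed.

(** Some term of the Leibniz expansion is nonzero, and its permutation is the required bijection.
    This will show that only proper colorings contribute. *)
Lemma sqdet_colored_neq0 colB colW : sqdet (colored_mx colB colW) != 0 ->
  exists2 f : X -> Y, bijective f &
    forall x, F x (f x) != 0 /\ compatible colB colW x (f x).
Proof.
rewrite det_colored => h.
have [s hs] : exists s : 'S_#|X|, (-1) ^+ s * ((\prod_i F (enum_val i) (y (s i)))
    * [forall i, compatible colB colW (enum_val i) (y (s i))]%:R) != 0.
  apply/existsP; apply: contraNT h; rewrite negb_exists => /forallP h.
  by rewrite big1 // => s _; apply/eqP; have := h s; rewrite negbK.
exists (fun x => y (s (enum_rank x))).
  exists (fun z => enum_val ((s^-1)%g (cast_ord (esym cardXY) (enum_rank z)))) => [x|z].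
    by rewrite enum_valK cast_ordK permK enum_rankK.
  by rewrite enum_valK permKV rank_y.
move: hs; rewrite !mulf_eq0 !negb_or pnatr_eq0 eqb0 negbK => /and3P[_ /prodf_neq0 hF /forallP hc] x.
by have := hF (enum_rank x) isT; have := hc (enum_rank x); rewrite enum_rankK.
Qed.
End Expansion.

(** * Orders on the colors of one side *)

Section Colors.
Variables (B W : finType) (n : B -> nat) (pos : B -> W -> nat).
Hypothesis pos_inj : forall b, injective (pos b).
Let C := {b : B & 'I_(n b)}.
Variable col : C -> W.
Let mk b (i : 'I_(n b)) : C := Tagged (fun b => 'I_(n b)) i.

Definition color_lex0 (y y' : C) : bool :=
  (enum_rank (tag y) < enum_rank (tag y'))%N
  || (tag y == tag y') && (tagged y < tagged y')%N.

Definition color_lex (y y' : C) : bool :=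
  lexlt pos (tag y) (col y) (tag y') (col y')
  || [&& tag y == tag y', col y == col y' & (tagged y < tagged y')%N].

Let mk_eq (y y' : C) : tag y = tag y' -> tagged y = tagged y' :> nat -> y = y'.
Proof.
by case: y y' => [b i] [b' i'] /= e; subst b' => /= /val_inj ->.
Qed.

Lemma tournament_color_lex0 : tournament color_lex0.
Proof.
split=> [y|y y' neq]; first by rewrite /color_lex0 !ltnn andbF.
rewrite /color_lex0 [tag y' == _]eq_sym; case: (eqVneq (tag y) (tag y')) => [e|ne] /=.
  have -> : (enum_rank (tag y) < enum_rank (tag y'))%N = false by rewrite e ltnn.
  have -> : (enum_rank (tag y') < enum_rank (tag y))%N = false by rewrite e ltnn.
  rewrite /=; case: ltngtP => // e'; by rewrite (mk_eq e e') eqxx in neq.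
by rewrite !orbF; apply: (tournament_ltn_on (inj_comp val_inj enum_rank_inj)).2.
Qed.

Lemma tournament_color_lex : tournament color_lex.
Proof.
have tl := tournament_lexlt pos_inj.
split=> [y|y y' neq]; first by rewrite /color_lex (tl.1 (tag y, col y)) ltnn !andbF.
rewrite /color_lex [tag y' == _]eq_sym [col y' == _]eq_sym.
have [e|ne] := eqVneq (tag y, col y) (tag y', col y').
  case: e => e1 e2.
  have -> : lexlt pos (tag y) (col y) (tag y') (col y') = false.
    by rewrite e1 e2 (tl.1 (tag y', col y')).
  have -> : lexlt pos (tag y') (col y') (tag y) (col y) = false.
    by rewrite e1 e2 (tl.1 (tag y', col y')).
  have -> : (tag y == tag y') = true by rewrite e1 eqxx.
  rewrite e2 eqxx /=.
  by case: ltngtP => // e'; rewrite (mk_eq e1 e') eqxx in neq.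
have /negPf -> : ~~ [&& tag y == tag y', col y == col y' & (tagged y < tagged y')%N].
  by apply: contraNN ne => /and3P[e1 e2 _]; apply/eqP; congr pair; apply/eqP.
have /negPf -> : ~~ [&& tag y == tag y', col y == col y' & (tagged y' < tagged y)%N].
  by apply: contraNN ne => /and3P[e1 e2 _]; apply/eqP; congr pair; apply/eqP.
by rewrite !orbF; apply: (tl.2 _ _ ne).
Qed.

Lemma big_colors (V : Type) (idx : V) (op : Monoid.com_law idx) (G : C -> V) :
  \big[op/idx]_y G y = \big[op/idx]_b \big[op/idx]_i G (@mk b i).
Proof.
rewrite (sig_big_dep (fun=> true) (fun _ _ => true) (fun b i => G (@mk b i))) /=.
by apply: eq_bigr => -[b i].
Qed.

(** Both orders compare the vertices first, so inversions occur only between colors at one vertex.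
    The vertex terms will be the signs c_v. *)
Lemma inv_color_lex : inversions color_lex0 color_lex =
  \sum_b inversions (fun i j : 'I_(n b) => i < j)%N (fun i j : 'I_(n b) =>
    (pos b (col (@mk b i)) < pos b (col (@mk b j)))%N
    || (col (@mk b i) == col (@mk b j)) && (i < j)%N).
Proof.
rewrite /inversions big_colors; apply: eq_bigr => b _; apply: eq_bigr => i _.
rewrite big_colors (bigD1 b) //= [X in _ + X]big1 ?addr0 => [|b' ne].
  by apply: eq_bigr => j _; rewrite /color_lex0 /color_lex /lexlt /= !ltnn !eqxx.
apply: big1 => j _; rewrite /color_lex0 /color_lex /lexlt /= eq_sym (negPf ne) /= !orbF.
by case: ltngtP.
Qed.

Lemma card_colors : #|{: C}| = (\sum_b n b)%N.
Proof.
rewrite -sum1_card big_colors; apply: eq_bigr => b _.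
by rewrite sum1_card card_ord.
Qed.

Lemma card_color_class b w :
  #|[set i : 'I_(n b) | col (@mk b i) == w]| = (\sum_y ((tag y == b) && (col y == w)))%N.
Proof.
rewrite big_colors (bigD1 b) //= [X in (_ + X)%N]big1 ?addn0 => [|b' /negPf ne].
  by rewrite -sum1_card big_mkcond; apply: eq_bigr => i _; rewrite inE eqxx /=; case: eqP.
by apply: big1 => i _; rewrite ne.
Qed.

Lemma sum_card_color_class b : (\sum_w #|[set i : 'I_(n b) | col (@mk b i) == w]| = n b)%N.
Proof.
under eq_bigr do rewrite -sum1_card big_mkcond; rewrite exchange_big /=.
rewrite -[RHS](card_ord (n b)) -sum1_card; apply: eq_bigr => i _.
rewrite (bigD1 (col (@mk b i))) //= inE eqxx big1 // => w ne.
by rewrite inE eq_sym (negPf ne).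
Qed.
End Colors.

(** * Strands *)

Section Web.
Variables (R : realFieldType) (B W : finType) (adj : B -> W -> bool).
Variables (sB : B -> {perm W}) (sW : W -> {perm B}) (outer : pred (dart B W)).
Variables (nB : B -> nat) (nW : W -> nat) (cB : B -> W) (cW : W -> B).
Variable eps : B -> W -> R.
Hypothesis total : (\sum_(b : B) nB b = \sum_(w : W) nW w)%N.
Hypothesis plane : plane_bipartite_graph adj sB sW outer.
Hypothesis cil : cilia_ok adj cB cW.
Hypothesis kast : kasteleyn adj sB sW outer nB nW cB cW eps.

Let rot : rotation_system adj sB sW. Proof. by case: plane. Qed.

Local Notation CB := (colorsB nB).
Local Notation CW := (colorsW nW).
Local Notation posB := (posB adj sB cB).
Local Notation posW := (posW adj sW cW).
Local Notation form := (inv_form (elB adj sB cB) (elW adj sW cW)).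

Let card_CWCB : #|{: CW}| = #|{: CB}|.
Proof. by rewrite !card_colors total. Qed.

Let K (phi : connection nB nW R) (x : CW) (y : CB) : R :=
  if adj (tag y) (tag x) then eps (tag y) (tag x) * phi (tag y) (tag x) (tagged x) (tagged y) else 0.

Let KC phi colB colW := colored_mx (fun x : CW => tag x) (fun y : CB => tag y) (K phi) colB colW.

Let KtildeE phi : sqdet (Ktilde adj eps phi)
  = \sum_(colB : {ffun CB -> W}) \sum_(colW : {ffun CW -> B}) sqdet (KC phi colB colW).
Proof. exact: sqdet_expand. Qed.

Let SsetE (colB : {ffun CB -> W}) b w :
  #|Sset colB b w| = (\sum_(y : CB) ((tag y == b) && (colB y == w)))%N.
Proof. exact: (card_color_class colB). Qed.

Let TsetE (colW : {ffun CW -> B}) b w :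
  #|Tset colW b w| = (\sum_(x : CW) ((tag x == w) && (colW x == b)))%N.
Proof. exact: (card_color_class colW). Qed.

(** The condition for a pair of colorings to come from a multiweb, whose values are then the sizes
    of the classes. *)
Definition proper_coloring (colB : {ffun CB -> W}) (colW : {ffun CW -> B}) : bool :=
  [forall b, forall w, (#|Tset colW b w| == #|Sset colB b w|)
                       && (adj b w || (#|Sset colB b w| == 0%N))].

(** A nonzero determinant yields a bijection between white and black colors that respects the
    assigned edges, so the classes on both sides have equal size and lie on edges of the graph. *)
Lemma sqdet_improper phi colB colW :
  ~~ proper_coloring colB colW -> sqdet (KC phi colB colW) = 0.
Proof.
move=> np; apply/eqP; apply: contraNT np => /(sqdet_colored_neq0 card_CWCB) [f bf hf].
apply/forallP=> b; apply/forallP=> w.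
have e : #|Tset colW b w| = #|Sset colB b w|.
  rewrite SsetE TsetE [RHS](reindex f) /=; last exact: onW_bij.
  by apply: eq_bigr => x _; have [_ /andP[/eqP-> /eqP->]] := hf x; rewrite andbC.
rewrite e eqxx /=; case: (boolP (adj b w)) => //= na; rewrite -e TsetE; apply/eqP/big1 => x _.
case: eqP => //= ew; case: eqP => //= eb.
have [] := hf x; rewrite /K => h /andP[_ /eqP e2]; move: h.
by rewrite (_ : adj _ _ = false) ?eqxx // -e2 eb ew (negPf na).
Qed.

(** The constant part of the sign: rows and columns of [Ktilde] follow the enumeration of a sigma
    type, which is compared here with the order by vertex and then color. *)
Definition kappaB : 'F_2 := inversions (fun y y' : CB => enum_rank y < enum_rank y')%N (@color_lex0 _ nB).
Definition kappaW : 'F_2 := inversions (fun x x' : CW => enum_rank x < enum_rank x')%N (@color_lex0 _ nW).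

(** * The contribution of one proper coloring *)

Section Strands.
Variables (colB : {ffun CB -> W}) (colW : {ffun CW -> B}).
Hypothesis proper : proper_coloring colB colW.

Let cardTS p : #|Tset colW p.1 p.2| = #|Sset colB p.1 p.2|.
Proof. by have /forallP/(_ p.1)/forallP/(_ p.2)/andP[/eqP] := proper. Qed.

Let adjS p : (0 < #|Sset colB p.1 p.2|)%N -> adj p.1 p.2.
Proof. by have /forallP/(_ p.1)/forallP/(_ p.2)/andP[_ /orP[//|/eqP->]] := proper. Qed.

(** One strand per unit of multiplicity. [sw] and [sb] give its colors at the two ends, with [T] and
    [S] matched in increasing order. *)
Let strand := {p : B * W & 'I_#|Tset colW p.1 p.2|}.
Let mkS p (k : 'I_#|Tset colW p.1 p.2|) : strand := Tagged (fun p => 'I_#|Tset colW p.1 p.2|) k.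

Let sw (s : strand) : CW :=
  Tagged (fun w => 'I_(nW w)) (enum_val (tagged s)).
Let sb (s : strand) : CB :=
  Tagged (fun b => 'I_(nB b)) (enum_val (cast_ord (cardTS (tag s)) (tagged s))).

Let col_sw s : colW (sw s) = (tag s).1.
Proof. by have := enum_valP (tagged s); rewrite inE => /eqP. Qed.

Let col_sb s : colB (sb s) = (tag s).2.
Proof. by have := enum_valP (cast_ord (cardTS (tag s)) (tagged s)); rewrite inE => /eqP. Qed.

Let sw_inj : injective sw.
Proof.
move=> s t e; have ep : tag s = tag t.
  rewrite [tag s]surjective_pairing [tag t]surjective_pairing -!col_sw e; congr pair.
  exact: (congr1 (@tag _ _) e).
case: s t e ep => p k [q l] /= e ep; subst q; congr (existT _ _ _); apply: enum_val_inj.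
by move/eqP: e; rewrite /sw eq_Tagged => /eqP.
Qed.

Let sb_inj : injective sb.
Proof.
move=> s t e; have ep : tag s = tag t.
  rewrite [tag s]surjective_pairing [tag t]surjective_pairing -!col_sb e; congr pair.
  exact: (congr1 (@tag _ _) e).
case: s t e ep => p k [q l] /= e ep; subst q; congr (existT _ _ _).
apply: (@cast_ord_inj _ _ (cardTS p)); apply: enum_val_inj.
by move/eqP: e; rewrite /sb eq_Tagged => /eqP.
Qed.

Let card_strand : #|{: strand}| = #|{: CW}|.
Proof.
rewrite (card_colors (fun p : B * W => #|Tset colW p.1 p.2|)).
under eq_bigr do rewrite TsetE; rewrite exchange_big -sum1_card; apply: eq_bigr => x _ /=.
rewrite (bigD1 (colW x, tag x)) //= !eqxx big1 // => -[b w] ne /=.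
by apply/eqP; rewrite eqb0; apply: contraNN ne => /andP[/eqP-> /eqP->].
Qed.

Let bij_sw : bijective sw.
Proof. by apply: inj_card_bij sw_inj _; rewrite card_strand. Qed.

Let bij_sb : bijective sb.
Proof. by apply: inj_card_bij sb_inj _; rewrite card_strand card_CWCB. Qed.

Let lexB := color_lex posB colB.
Let lexW := color_lex posW colW.
Let rankB (y y' : CB) := (enum_rank y < enum_rank y')%N.
Let rankW (x x' : CW) := (enum_rank x < enum_rank x')%N.

Let mbar : {ffun B * W -> 'F_2} := [ffun p => #|Sset colB p.1 p.2|%:R].

(** Strands on the same edge have the same order at both ends, and strands on distinct edges compare
    as these edges do. A pair of edges is thus counted as often as the product of its
    multiplicities. *)
Let inv_strands :
  inversions (fun s t => lexW (sw s) (sw t)) (fun s t => lexB (sb s) (sb t)) = form mbar.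
Proof.
rewrite inv_sym /inversions (big_colors (n := fun p : B * W => #|Tset colW p.1 p.2|)) /inv_form; apply: eq_bigr => p _.
under eq_bigr => k _ do rewrite (big_colors (n := fun p : B * W => #|Tset colW p.1 p.2|)).
rewrite exchange_big; apply: eq_bigr => q _ /=.
have cell (k : 'I_#|Tset colW p.1 p.2|) (l : 'I_#|Tset colW q.1 q.2|) :
    lexB (sb (mkS k)) (sb (mkS l)) && lexW (sw (mkS l)) (sw (mkS k))
    = elB adj sB cB p q && elW adj sW cW q p.
  rewrite /lexB /lexW /color_lex !col_sb !col_sw /=.
  rewrite -/(elB adj sB cB p q) -/(elW adj sW cW q p).
  have [e|ne] := eqVneq p q.
    subst q; rewrite (tournament_elB adj sB cB).1 (tournament_elW adj sW cW).1 !eqxx /=.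
    by rewrite !ltn_enum_val /=; case: ltngtP.
  have /negPf -> : ~~ [&& p.1 == q.1, p.2 == q.2 & (enum_val (cast_ord (cardTS p) k)
      < enum_val (cast_ord (cardTS q) l))%N].
    apply: contraNN ne => /and3P[e1 e2 _].
    by rewrite [p]surjective_pairing [q]surjective_pairing (eqP e1) (eqP e2).
  have /negPf -> : ~~ [&& q.2 == p.2, q.1 == p.1 & (enum_val l < enum_val k)%N].
    apply: contraNN ne => /and3P[e2 e1 _].
    by rewrite [p]surjective_pairing [q]surjective_pairing (eqP e1) (eqP e2).
  by rewrite !orbF.
under eq_bigr => k _ do under eq_bigr => l _ do rewrite cell.
by rewrite !sumr_const !card_ord !ffunE -!cardTS -natrM [RHS]mulr_natl mulnC mulrnA.
Qed.

Let sign_BE : sg R (inversions (@color_lex0 _ nB) lexB) = \prod_b sign_B adj sB cB R colB b.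
Proof.
rewrite inv_color_lex sg_sum; apply: eq_bigr => b _.
have cadj (i : 'I_(nB b)) : adj b (colB (Tagged (fun b => 'I_(nB b)) i)).
  by apply: (@adjS (b, _)); apply/card_gt0P; exists i; rewrite inE.
rewrite /sign_B sign_of_flatten_blocks.
- by congr sg; apply: eq_inv => // i j; rewrite !(posBE rot cil (cadj _)).
- exact: (uniq_edge_order_B rot cil).
- by move=> i; apply: (mem_edge_order_B rot cil (cadj i)).
Qed.

Let sign_WE : sg R (inversions (@color_lex0 _ nW) lexW) = \prod_w sign_W adj sW cW R colW w.
Proof.
rewrite inv_color_lex sg_sum; apply: eq_bigr => w _.
have cadj (i : 'I_(nW w)) : adj (colW (Tagged (fun w => 'I_(nW w)) i)) w.
  by apply: (@adjS (_, w)); rewrite -cardTS; apply/card_gt0P; exists i; rewrite inE.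
rewrite /sign_W sign_of_flatten_blocks.
- by congr sg; apply: eq_inv => // i j; rewrite !(posWE rot cil (cadj _)).
- exact: (uniq_edge_order_W rot cil).
- by move=> i; apply: (mem_edge_order_W rot cil (cadj i)).
Qed.

(** The comparison runs through the chain [rankW], white [color_lex0], [lexW], [lexB], black
    [color_lex0], [rankB]. The outer steps give the constants, the middle one the form, and the
    remaining two the vertex signs. *)
Let sign_strands : sg R (inversions (fun s t => rankW (sw s) (sw t)) (fun s t => rankB (sb s) (sb t)))
  = sg R (kappaB + kappaW) * sg R (form mbar)
    * ((\prod_b sign_B adj sB cB R colB b) * (\prod_w sign_W adj sW cW R colW w)).
Proof.
have tlB : tournament lexB by apply/tournament_color_lex/posB_inj.
have tlW : tournament lexW by apply/tournament_color_lex/posW_inj.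
have trB : tournament rankB.
  by apply: tournament_ltn_on => y y' /val_inj/enum_rank_inj.
have trW : tournament rankW.
  by apply: tournament_ltn_on => y y' /val_inj/enum_rank_inj.
have t0B : tournament (@color_lex0 _ nB) by apply: tournament_color_lex0.
have t0W : tournament (@color_lex0 _ nW) by apply: tournament_color_lex0.
rewrite (inv_trans (r2 := fun s t => lexW (sw s) (sw t))); [|exact: tournament_pre..].
rewrite [X in _ + X](inv_trans (r2 := fun s t => lexB (sb s) (sb t))); [|exact: tournament_pre..].
rewrite inv_strands (inv_reindex rankW lexW bij_sw) (inv_reindex lexB rankB bij_sb).
rewrite (inv_sym lexB) (inv_trans trW t0W tlW) (inv_trans trB t0B tlB) !sgD sign_BE sign_WE.
by rewrite -/kappaB -/kappaW; ring.
Qed.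

Let strand_entry phi p (k l : 'I_#|Tset colW p.1 p.2|) :
  K phi (sw (mkS k)) (sb (mkS l)) * (compatible (fun x : CW => tag x) (fun y : CB => tag y)
    colB colW (sw (mkS k)) (sb (mkS l)))%:R
  = sg R (eps_bit eps p) * phi p.1 p.2 (enum_val k) (enum_val (cast_ord (cardTS p) l)).
Proof.
rewrite /compatible col_sb col_sw /= !eqxx mulr1 /K /=.
have a : adj p.1 p.2.
  by apply: adjS; rewrite -cardTS; apply: leq_ltn_trans (ltn_ord k).
by rewrite a (eps_bitE kast a); case: p k l a.
Qed.

(** Indexed by strands, the matrix is block diagonal with one block per edge, since compatible
    colors lie on the same edge. Factoring [eps] out of the blocks gives the linear part of [kform];
    the reordering gives the rest of the sign. *)
Lemma sqdet_proper phi : sqdet (KC phi colB colW) =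
  sg R (kappaB + kappaW) * sg R (kform adj sB sW cB cW eps mbar) *
  ((\prod_b sign_B adj sB cB R colB b) * (\prod_w sign_W adj sW cW R colW w)
   * \prod_(p : B * W | (0 < #|Sset colB p.1 p.2|)%N)
       sqdet (submx_TS phi (Tset colW p.1 p.2) (Sset colB p.1 p.2))).
Proof.
pose f (i : 'I_#|{: strand}|) : 'I_#|{: CW}| := enum_rank (sw (enum_val i)).
pose g (i : 'I_#|{: strand}|) : 'I_#|{: CB}| := enum_rank (sb (enum_val i)).
have injf : injective f by move=> i j /enum_rank_inj/sw_inj/enum_val_inj.
have injg : injective g by move=> i j /enum_rank_inj/sb_inj/enum_val_inj.
rewrite (@sqdet_mxsub _ _ _ _ _ f g) //; last by rewrite -card_CWCB card_strand.
rewrite -[inversions _ _]/(inversions (fun i j => (fun s t => rankW (sw s) (sw t)) (enum_val i) (enum_val j))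
  (fun i j => (fun s t => rankB (sb s) (sb t)) (enum_val i) (enum_val j))).
rewrite (inv_reindex _ _ (@enum_val_bij strand)) sign_strands.
pose G (s t : strand) := K phi (sw s) (sb t)
  * (compatible (fun x : CW => tag x) (fun y : CB => tag y) colB colW (sw s) (sb t))%:R.
have -> : mxsub f g (KC phi colB colW) = \matrix_(i, j) G (enum_val i) (enum_val j).
  by apply/matrixP=> i j; rewrite !mxE !enum_rankK.
rewrite (det_block_diag (Phi := fun p => \matrix_(k, l)
  (sg R (eps_bit eps p) * phi p.1 p.2 (enum_val k) (enum_val (cast_ord (cardTS p) l))))); first last.
- move=> s t ne; rewrite /G /compatible col_sb col_sw /=.
  case: eqP => [e2|]; last by rewrite mulr0.
  case: eqP => [e1|]; last by rewrite mulr0.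
  by case/eqP: ne; rewrite [tag s]surjective_pairing [tag t]surjective_pairing e1 e2.
- by move=> p k l; rewrite mxE; apply: strand_entry.
have blockE p : \det (\matrix_(k, l) (sg R (eps_bit eps p)
    * phi p.1 p.2 (enum_val k) (enum_val (cast_ord (cardTS p) l))))
  = sg R (eps_bit eps p * mbar p) * sqdet (submx_TS phi (Tset colW p.1 p.2) (Sset colB p.1 p.2)).
  rewrite (sqdet_cast (cardTS p)).
  have -> : sg R (eps_bit eps p * mbar p) = sg R (eps_bit eps p) ^+ #|Tset colW p.1 p.2|.
    by rewrite ffunE -cardTS mulr_natr sgMn.
  by rewrite -detZ; congr (\det _); apply/matrixP=> k l; rewrite !mxE.
rewrite (eq_bigr _ (fun p _ => blockE p)) big_split /= -sg_sum /kform.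
(* An edge of multiplicity zero has an empty minor, of determinant 1. *)
have -> : \prod_p sqdet (submx_TS phi (Tset colW p.1 p.2) (Sset colB p.1 p.2))
    = \prod_(p : B * W | (0 < #|Sset colB p.1 p.2|)%N)
       sqdet (submx_TS phi (Tset colW p.1 p.2) (Sset colB p.1 p.2)).
  rewrite [RHS]big_mkcond; apply: eq_bigr => p _; case: ltnP => // le0.
  by apply: det_size0; apply/eqP; rewrite cardTS -leqn0.
by rewrite mulrACA -[X in X * _]mulrA -!sgD.
Qed.
End Strands.

(** * Summation over multiwebs *)

Let coloring_web (colB : {ffun CB -> W}) : mweb W nB := [ffun p => inord #|Sset colB p.1 p.2|].

Let coloring_webE colB p : val (coloring_web colB p) = #|Sset colB p.1 p.2|.
Proof.
rewrite ffunE /= inordK // ltnS; apply: leq_trans (max_card _) _.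
by rewrite card_ord /total_mult (bigD1 p.1) //= leq_addr.
Qed.

(** A proper coloring determines its multiweb through the class sizes, and the vertex sums hold
    because the classes partition the colors. This turns the double sum over multiwebs and colorings
    into a single sum over proper colorings. *)
Lemma coloring_of_multiweb (m : mweb W nB) colB colW :
  is_multiweb adj nW m && is_coloring m colB colW
  = proper_coloring colB colW && (m == coloring_web colB).
Proof.
apply/andP/andP=> [[/and3P[/forallP m0 _ _] /forallP mC]|[pr /eqP->]].
  have mE b w := forallP (mC b) w.
  split; last first.
    apply/eqP/ffunP=> -[b w]; apply: val_inj; rewrite coloring_webE.
    by have /andP[/eqP] := mE b w.
  apply/forallP=> b; apply/forallP=> w; have /andP[/eqP-> /eqP->] := mE b w.
  by rewrite eqxx /=; have /implyP := m0 (b, w) => /=; case: (adj b w) => //= ->.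
have prE b w := andP (forallP (forallP pr b) w).
split; last first.
  apply/forallP=> b; apply/forallP=> w; rewrite coloring_webE eqxx /=.
  by case: (prE b w).
apply/and3P; split; apply/forallP.
- move=> [b w]; apply/implyP => /= na; rewrite coloring_webE /=.
  by case: (prE b w) => _; rewrite (negPf na).
- move=> b; under eq_bigr do rewrite coloring_webE /=.
  by apply/eqP; apply: (sum_card_color_class colB).
- move=> w; under eq_bigr => b _.
    rewrite coloring_webE /= -(eqP (prE b w).1); over.
  by apply/eqP; apply: (sum_card_color_class colW).
Qed.

Lemma multiweb_mod2 (m : mweb W nB) : is_multiweb adj nW m ->
  mod2_web adj nB nW [ffun p => (val (m p))%:R].
Proof.
case/and3P=> /forallP m0 /forallP mB /forallP mW; split=> [b w na|b|w].
- by have /implyP/(_ na)/eqP := m0 (b, w); rewrite ffunE => ->.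
- by under eq_bigr do rewrite ffunE; rewrite -natr_sum (eqP (mB b)).
- by under eq_bigr do rewrite ffunE; rewrite -natr_sum (eqP (mW w)).
Qed.

Let webQ (m : mweb W nB) : 'F_2 := kform adj sB sW cB cW eps [ffun p => (val (m p))%:R].

Lemma det_Ktilde_traces (phi : connection nB nW R) : sqdet (Ktilde adj eps phi)
  = \sum_(m : mweb W nB | is_multiweb adj nW m)
      sg R (kappaB + kappaW) * sg R (webQ m) * Tr adj sB sW cB cW phi m.
Proof.
rewrite KtildeE; under [RHS]eq_bigr => m _.
  rewrite mulr_sumr; under eq_bigr do rewrite mulr_sumr big_mkcond /=; over.
rewrite [RHS]exchange_big; apply: eq_bigr => colB _ /=.
rewrite [RHS]exchange_big; apply: eq_bigr => colW _ /=.
rewrite -big_mkcondr /=; under [RHS]eq_bigl do rewrite coloring_of_multiweb.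
have [pr|np] := boolP (proper_coloring colB colW); last first.
  by rewrite sqdet_improper // big_pred0.
rewrite big_pred1_eq (sqdet_proper pr); congr (_ * sg R (kform _ _ _ _ _ _ _) * (_ * _)).
  by apply/ffunP=> p; rewrite [LHS]ffunE [RHS]ffunE coloring_webE.
by apply: eq_bigl => p; rewrite coloring_webE.
Qed.

Lemma det_Ktilde_sign : exists2 s : R, (s = 1 \/ s = -1) &
  forall phi : connection nB nW R, sqdet (Ktilde adj eps phi)
    = s * \sum_(m : mweb W nB | is_multiweb adj nW m) Tr adj sB sW cB cW phi m.
Proof.
(* The sign is read off any one multiweb. If there is none, both sides vanish and the sign 1 is
   chosen. *)
case: (pickP (is_multiweb (nB := nB) adj nW)) => [m0 hm0|none]; last first.
  by exists 1 => [|phi]; [left | rewrite det_Ktilde_traces !big_pred0 ?mulr0].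
exists (sg R (kappaB + kappaW + webQ m0)) => [|phi]; first exact: sgP.
rewrite det_Ktilde_traces mulr_sumr; apply: eq_bigr => m hm; rewrite -sgD.
by rewrite /webQ (kform_const plane cil kast (multiweb_mod2 hm) (multiweb_mod2 hm0)).
Qed.
End Web.

Theorem theorem3 (R : realFieldType) (B W : finType) (adj : B -> W -> bool)
  (sB : B -> {perm W}) (sW : W -> {perm B}) (outer : pred (dart B W))
  (nB : B -> nat) (nW : W -> nat) (cB : B -> W) (cW : W -> B)
  (eps : B -> W -> R) :
  (forall b, 0 < nB b)%N -> (forall w, 0 < nW w)%N ->
  (\sum_(b : B) nB b = \sum_(w : W) nW w)%N ->
  plane_bipartite_graph adj sB sW outer ->
  cilia_ok adj cB cW ->
  kasteleyn adj sB sW outer nB nW cB cW eps ->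
  exists2 s : R, (s = 1 \/ s = -1) &
    forall phi : connection nB nW R,
      sqdet (Ktilde adj eps phi)
      = s * \sum_(m : mweb W nB | is_multiweb adj nW m)
              Tr adj sB sW cB cW phi m.
Proof. by move=> _ _ total plane cil kast; apply: det_Ktilde_sign total plane cil kast. Qed.
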